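(* Let $p$ be a linear operator on $L^2(\mathbb{R}^d)\cap L^\infty(\mathbb{R}^d)$ which is a contraction with respect to the norm $\|\cdot\|_\infty$, i.e. $\|p(f)\|_\infty\le\|f\|_\infty$ for all $f\in L^2(\mathbb{R}^d)\cap L^\infty(\mathbb{R}^d)$. Then the quadratic second quantization $\Gamma_2(p)$ is an orthogonal projection on the quadratic Fock space $\Gamma_2(L^2(\mathbb{R}^d)\cap L^\infty(\mathbb{R}^d))$ if and only if there is a (measurable) set $I\subset\mathbb{R}^d$ such that $p=\mathcal{M}_{\chi_I}$, where $\mathcal{M}_{\chi_I}f=\chi_I f$ is the operator of multiplication by the characteristic function $\chi_I$ of $I$.
   Context: Functions are complex valued, identified almost everywhere; $\mathcal{A}:=L^2(\mathbb{R}^d)\cap L^\infty(\mathbb{R}^d)$; $\langle f,g\rangle=\int_{\mathbb{R}^d}\overline{f(s)}g(s)\,ds$; all inner products are conjugate-linear in the first variable. Fix a constant $c>0$. Renormalized square of white noise (RSWN): the $*$-Lie algebra with central element $1$ and generators $B^+_f,B_f,N_f$ ($f\in\mathcal{A}$), where $f\mapsto B^+_f$ and $f\mapsto N_f$ are linear and $f\mapsto B_f$ is conjugate-linear, with involution $(B^+_f)^*=B_f$, $N_f^*=N_{\bar f}$ and commutation relations $[B_f,B^+_g]=2c\langle f,g\rangle+4N_{\bar f g}$, $[N_a,B^+_f]=2B^+_{af}$, $[B^+_f,B^+_g]=[B_f,B_g]=[N_a,N_{a'}]=0$ for all $a,a',f,g\in\mathcal{A}$. Its Fock representation is characterized by a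 cyclic unit vector $\Phi$ with $B_f\Phi=N_g\Phi=0$ for all $f,g\in\mathcal{A}$. Quadratic Fock space: $\Gamma_2(\mathcal{A})$ is the Hilbert space which is the closed linear span of $\{B^{+n}_f\Phi : n\in\mathbb{N},\ f\in\mathcal{A}\}$, where $B^{+n}_f=(B^+_f)^n$ and $B^{+0}_f\Phi=\Phi$. Its inner product is determined by: $\langle B^{+n}_f\Phi,B^{+m}_g\Phi\rangle=0$ for $n\ne m$, $\langle\Phi,\Phi\rangle=1$, and for $n\ge1$ $$\langle B^{+n}_f\Phi,B^{+n}_g\Phi\rangle=c\sum_{k=0}^{n-1}2^{2k+1}\frac{n!(n-1)!}{((n-k-1)!)^2}\langle f^{k+1},g^{k+1}\rangle\langle B^{+(n-k-1)}_f\Phi,B^{+(n-k-1)}_g\Phi\rangle .$$ Quadratic exponential vectors: $\Psi(f)=\sum_{n\ge0}\frac{1}{n!}B^{+n}_f\Phi$, which exists for $\|f\|_\infty<\frac12$, with $\Psi(0)=\Phi$. For $\|f\|_\infty,\|g\|_\infty<\frac12$ one has $\langle\Psi(f),\Psi(g)\rangle=\exp\left(-\frac c2\int_{\mathbb{R}^d}\ln(1-4\bar f(s)g(s))\,ds\right)$. These vectors are known to be linearly independent and total in $\Gamma_2(\mathcal{A})$. Quadratic second quantization: for a linear operator $T$ on $\mathcal{A}$ that is a contraction for $\|\cdot\|_\infty$, $\Gamma_2(T)$ is the linear operator defined on the linear span of $\{\Psi(f): f\in\mathcal{A},\ \|f\|_\infty<\frac12\}$ by $\Gamma_2(T)\Psi(f)=\Psi(Tf)$.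 Saying that $\Gamma_2(T)$ is an orthogonal projection on $\Gamma_2(\mathcal{A})$ means that it extends to a bounded operator on $\Gamma_2(\mathcal{A})$ which is an orthogonal projection (self-adjoint idempotent). *)

(* Defs.v *)
From HB Require Import structures.
From mathcomp Require Import all_boot all_order all_algebra.
From mathcomp Require Import complex.
From mathcomp Require Import all_classical all_reals all_analysis.
From mathcomp Require Import measurable_realfun ess_sup_inf.

Set Implicit Arguments.
Unset Strict Implicit.
Unset Printing Implicit Defensive.

Import Order.TTheory GRing.Theory Num.Theory.
Import numFieldTopology.Exports numFieldNormedType.Exports.

Local Open Scope classical_set_scope.
Local Open Scope ring_scope.

Section lebesgue_tuple.
Context (R : realType).
Local Notation mR := (measurableTypeR R).

Definition tuple_cons n (x : mR * n.-tuple mR) : n.+1.-tuple mR :=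
  [tuple of x.1 :: x.2].

Lemma measurable_tuple_cons n : measurable_fun setT (@tuple_cons n).
Proof. exact: measurable_cons. Qed.

Section step.
Variables (n : nat) (m : {sigma_finite_measure set (n.-tuple mR) -> \bar R}).

Definition lebesgue_step : set (n.+1.-tuple mR) -> \bar R :=
  pushforward (@lebesgue_measure R \x m)%E (@tuple_cons n).

HB.instance Definition _ := Measure.copy lebesgue_step
  (measure_function_pushforward__canonical__measure_function_Measure
    (@lebesgue_measure R \x m)%E (@measurable_tuple_cons n)).

Let lebesgue_step_sigma_finite : sigma_finite setT lebesgue_step.
Proof.
have /sigma_finiteP[F [FT ndF Foo]] := sigma_finiteT (@lebesgue_measure R).
have /sigma_finiteP[G [GT ndG Goo]] := sigma_finiteT m.
pose uncons (t : n.+1.-tuple mR) := (thead t, [tuple of behead t] : n.-tuple mR).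
have muncons : measurable_fun setT uncons.
  by apply: measurable_fun_pair; [exact: measurable_tnth|exact: measurable_behead].
exists (fun k => uncons @^-1` (F k `*` G k)).
  rewrite -preimage_bigcup (_ : \bigcup_i _ = setT) ?preimage_setT//.
  apply/seteqP; split=> // -[x t] _.
  have [i _ Fix] : (\bigcup_i F i) x by rewrite -FT.
  have [j _ Gjt] : (\bigcup_i G i) t by rewrite -GT.
  exists (maxn i j) => //; split => /=.
    by move: x Fix; exact/subsetPset/ndF/leq_maxl.
  by move: t Gjt; exact/subsetPset/ndG/leq_maxr.
move=> k; have [mFk Fkoo] := Foo k; have [mGk Gkoo] := Goo k; split.
  by rewrite -[X in measurable X]setTI; apply: muncons => //; exact: measurableX.
rewrite /lebesgue_step /pushforward -comp_preimage.
rewrite (_ : uncons \o _ = id) ?preimage_id.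
  by rewrite product_measure1E// lte_mul_pinfty// ge0_fin_numE.
apply/funext => -[x t]; rewrite /= /uncons theadE; congr pair; exact/val_inj.
Qed.

HB.instance Definition _ := Measure_isSigmaFinite.Build _ _ _ lebesgue_step
  lebesgue_step_sigma_finite.

End step.

Fixpoint lebesgue_tuple n : {sigma_finite_measure set (n.-tuple mR) -> \bar R} :=
  match n with
  | 0 => \d_([tuple] : 0.-tuple mR)
  | k.+1 => lebesgue_step (lebesgue_tuple k)
  end.

End lebesgue_tuple.

Section lebesgue_box.
Context (R : realType).
Local Notation mR := (measurableTypeR R).

Lemma lebesgue_tuple_box n (A : 'I_n -> set mR) :
  (forall i, measurable (A i)) ->
  lebesgue_tuple R n [set t | forall i, A i (tnth t i)] =
  (\prod_(i < n) lebesgue_measure (A i))%E.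
Proof.
elim: n A => [|n IH] A mA.
  rewrite big_ord0 /= diracE mem_set//= => i.
  by case: i.
rewrite big_ord_recl -IH//= /lebesgue_step /pushforward.
rewrite [X in (_ \x _)%E X](_ : _ =
  A ord0 `*` [set t | forall i, A (lift ord0 i) (tnth t i)]).
  rewrite product_measure1E//.
  rewrite (_ : [set _ | _] =
    \big[setI/setT]_(i < n) ((@tnth n mR)^~ i @^-1` A (lift ord0 i))).
    apply: bigsetI_measurable => i _.
    by rewrite -[X in measurable X]setTI; exact: measurable_tnth.
  apply/seteqP; split=> t.
    by move=> tA; rewrite -bigcap_seq => i /= _; exact: tA.
  by rewrite -bigcap_seq => tA i; apply: tA => /=; exact: mem_index_enum.
apply/seteqP; split=> -[x t] /=.
  move=> xtA; split=> [|i]; first exact: (xtA ord0).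
  by have := xtA (lift ord0 i); rewrite /tuple_cons tnthS.
case=> xA tA i; have [j ->|->] := unliftP ord0 i; last exact: xA.
by rewrite /tuple_cons tnthS; exact: tA.
Qed.

End lebesgue_box.

Section L2oo.
Context {dd : measure_display} {T : measurableType dd} {R : realType}.
Variable mu : {measure set T -> \bar R}.
Local Notation C := R[i].
Local Notation normc := (@ComplexField.Normc.normc R).
Local Notation Re := (@complex.Re R).
Local Notation Im := (@complex.Im R).
Implicit Types f g : T -> C.

Definition L2oo_pred : {pred T -> C} := mem [set f : T -> C |
  [/\ measurable_fun setT (fun x => Re (f x)),
      measurable_fun setT (fun x => Im (f x)),
      finite_norm mu 2%:E (normc \o f) &
      finite_norm mu +oo (normc \o f)]].

Lemma normc_ge0 (z : C) : 0 <= normc z.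
Proof. by case: z => a b; exact: sqrtr_ge0. Qed.

Lemma measurable_normc f :
  measurable_fun setT (fun x => Re (f x)) ->
  measurable_fun setT (fun x => Im (f x)) ->
  measurable_fun setT (normc \o f).
Proof.
move=> mr mi.
rewrite (_ : _ \o _ = (fun x => Num.sqrt (Re (f x) ^+ 2 + Im (f x) ^+ 2))).
  apply: (@measurableT_comp _ _ _ _ _ _ (@Num.sqrt R)).
    by apply: continuous_measurable_fun; exact: sqrt_continuous.
  by apply: measurable_funD; apply: measurable_funX.
by apply/funext => x /=; case: (f x).
Qed.

Lemma L2oo_mfun f : f \in L2oo_pred -> measurable_fun setT (normc \o f).
Proof. by move=> /set_mem[mr mi _ _]; exact: measurable_normc. Qed.

Lemma L2oo_Lfun f : f \in L2oo_pred ->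
  normc \o f \in Lfun mu 2%:E /\ normc \o f \in Lfun mu +oo.
Proof.
move=> fL; have mf := L2oo_mfun fL.
by move: fL => /set_mem[_ _ f2 foo]; split; apply/andP;
  (split; apply/mem_set).
Qed.

Lemma le_finite_norm (p : \bar R) (u v : T -> R) : p = 2%:E \/ p = +oo%E ->
  measurable_fun setT u -> v \in Lfun mu p ->
  {ae mu, forall x, `|u x| <= `|v x|} -> finite_norm mu p u.
Proof.
move=> pE mu_ /andP[/set_mem/= mv /set_mem/= vfin] uv.
apply: le_lt_trans vfin; rewrite unlock; case: pE => ->.
  rewrite gt0_ler_poweR ?invr_ge0 ?ler0n//.
  - by rewrite in_itv/= leey integral_ge0// => x _; exact: poweR_ge0.
  - by rewrite in_itv/= leey integral_ge0// => x _; exact: poweR_ge0.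
  apply: ae_ge0_le_integral => //.
  - by move=> x _; exact: poweR_ge0.
  - apply/measurable_EFinP/(@measurableT_comp _ _ _ _ _ _ (fun x : R => x `^ 2)%R) => //.
    exact: measurableT_comp.
  - by move=> x _; exact: poweR_ge0.
  - apply/measurable_EFinP/(@measurableT_comp _ _ _ _ _ _ (fun x : R => x `^ 2)%R) => //.
    exact: measurableT_comp.
  - apply: filterS uv => x uvx _; rewrite lee_fin.
    by apply: ge0_ler_powR; rewrite ?nnegrE ?ler0n//.
case: ifPn => // _; apply: le_ess_sup.
by apply: filterS uv => x /=; rewrite lee_fin.
Qed.

Lemma L2oo_dom f (v : T -> R) :
  measurable_fun setT (fun x => Re (f x)) ->
  measurable_fun setT (fun x => Im (f x)) ->
  v \in Lfun mu 2%:E -> v \in Lfun mu +oo ->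
  {ae mu, forall x, normc (f x) <= v x} -> f \in L2oo_pred.
Proof.
move=> mr mi v2 voo fv; apply/mem_set.
have fv' : {ae mu, forall x, `|(normc \o f) x| <= `|v x|}.
  apply: filterS fv => x /= fvx.
  by rewrite ger0_norm ?normc_ge0// (le_trans fvx)// ler_norm.
by split=> //; apply: (@le_finite_norm _ _ v) => //;
  [left|exact: measurable_normc|right|exact: measurable_normc].
Qed.

Lemma L2oo_submod_closed : submod_closed L2oo_pred.
Proof.
split=> [|a f g fL gL].
  apply/mem_set; split; rewrite ?[X in measurable_fun _ X](_ : _ = cst 0)//.
  - rewrite (_ : _ \o _ = cst 0); last first.
      by apply/funext => x /=; rewrite expr0n/= addr0 sqrtr0.
    by rewrite /finite_norm Lnorm0.
  - rewrite (_ : _ \o _ = cst 0); last first.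
      by apply/funext => x /=; rewrite expr0n/= addr0 sqrtr0.
    by rewrite /finite_norm Lnorm0.
have [f2 foo] := L2oo_Lfun fL.
have [g2 goo] := L2oo_Lfun gL.
move: fL gL => /set_mem[mrf mif _ _] /set_mem[mrg mig _ _].
apply: (@L2oo_dom _ (normc a *: (normc \o f) + (normc \o g))).
- rewrite (_ : (fun _ => _) =
    (fun x => Re a * Re (f x) - Im a * Im (f x) + Re (g x))).
    apply: measurable_funD => //.
    by apply: measurable_funB; apply: measurable_funM.
  by apply/funext => x; rewrite !fctE; case: (a) (f x) (g x) => ? ? [? ?] [].
- rewrite (_ : (fun _ => _) =
    (fun x => Re a * Im (f x) + Im a * Re (f x) + Im (g x))).
    apply: measurable_funD => //.
    by apply: measurable_funD; apply: measurable_funM.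
  by apply/funext => x; rewrite !fctE; case: (a) (f x) (g x) => ? ? [? ?] [].
- have [_ L] := @Lfun_submod_closed _ _ _ mu _ (lee1n 2).
  exact: L.
- have [_ L] := @Lfun_submod_closed _ _ _ mu +oo%E (leey 1).
  exact: L.
- apply: nearW => x; rewrite !fctE /=.
  rewrite (le_trans (le_normcD _ _))// lerD2r.
  by have /= -> := ComplexField.Normc.normcM a (f x).
Qed.

HB.instance Definition _ := GRing.isSubmodClosed.Build _ _ L2oo_pred
  L2oo_submod_closed.

Record L2oo_fun := L2ooFun {
  L2oo_val :> T -> C ;
  L2oo_valP : L2oo_val \in L2oo_pred }.

HB.instance Definition _ := [isSub for L2oo_val].
HB.instance Definition _ := [Choice of L2oo_fun by <:].
HB.instance Definition _ := [SubChoice_isSubLmodule of L2oo_fun by <:].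

Definition ae_zero : {pred L2oo_fun} :=
  mem [set f : L2oo_fun | {ae mu, forall x, f x = 0}].

Lemma ae_zero_submod_closed : submod_closed ae_zero.
Proof.
split=> [|a f g]; first by rewrite inE; exact: nearW.
rewrite !inE => f0 g0; apply: filterS2 f0 g0 => x f0 g0.
by rewrite /= !fctE f0 g0 scaler0 addr0.
Qed.

HB.instance Definition _ := GRing.isSubmodClosed.Build _ _ ae_zero
  ae_zero_submod_closed.

Definition L2oo : Type := Quotient.quot ae_zero.

HB.instance Definition _ := Choice.on L2oo.
HB.instance Definition _ := EqQuotient.on L2oo.
HB.instance Definition _ := GRing.Zmodule.on L2oo.

End L2oo.

Section L2oo_repr.
Context {dd : measure_display} {T : measurableType dd} {R : realType}.
Variable mu : {measure set T -> \bar R}.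
Local Notation C := R[i].
Local Notation normc := (@ComplexField.Normc.normc R).
Local Notation Re := (@complex.Re R).
Local Notation Im := (@complex.Im R).
Local Notation A := (L2oo mu).
Local Open Scope quotient_scope.

Definition L2oo_class (f : L2oo_fun mu) : A := \pi f.
Definition L2oo_repr (f : A) : L2oo_fun mu := repr f.
Definition L2oo_to_fun (f : A) : T -> C := L2oo_repr f.

End L2oo_repr.

Arguments L2oo_class {dd T R mu} f.
Arguments L2oo_repr {dd T R mu} f.
Arguments L2oo_to_fun {dd T R mu} f.

Coercion L2oo_to_fun : L2oo >-> Funclass.

Section L2oo_theory.
Context {dd : measure_display} {T : measurableType dd} {R : realType}.
Variable mu : {measure set T -> \bar R}.
Local Notation C := R[i].
Local Notation normc := (@ComplexField.Normc.normc R).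
Local Notation Re := (@complex.Re R).
Local Notation Im := (@complex.Im R).
Local Notation A := (L2oo mu).
Local Open Scope quotient_scope.


Lemma L2oo_classP (f g : L2oo_fun mu) :
  L2oo_class f = L2oo_class g <-> {ae mu, forall x, f x = g x}.
Proof.
split=> [/eqP|fg].
  rewrite -Quotient.idealrBE => /set_mem; apply: filterS => x /= /eqP.
  by rewrite !fctE subr_eq0 => /eqP.
apply/eqP; rewrite -Quotient.idealrBE; apply/mem_set.
by apply: filterS fg => x /= fgx; rewrite !fctE fgx subrr.
Qed.

Lemma L2oo_reprK : cancel (@L2oo_repr _ _ _ mu) L2oo_class.
Proof. exact: reprK. Qed.

Lemma L2oo_class_ae (f : L2oo_fun mu) :
  {ae mu, forall x, L2oo_class f x = f x}.
Proof. by apply/L2oo_classP; rewrite L2oo_reprK. Qed.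

Lemma L2ooP (f g : A) : f = g <-> {ae mu, forall x, f x = g x}.
Proof.
split=> [->|fg]; first exact: nearW.
by rewrite -[f]L2oo_reprK -[g]L2oo_reprK; apply/L2oo_classP.
Qed.

Lemma L2oo_addE (f g : L2oo_fun mu) :
  L2oo_class (f + g) = L2oo_class f + L2oo_class g.
Proof. by rewrite /L2oo_class [LHS]Quotient.pi_add. Qed.

Definition L2oo_scale (a : C) (f : A) : A := L2oo_class (a *: L2oo_repr f).

Lemma L2oo_scaleE (a : C) (f : L2oo_fun mu) :
  L2oo_class (a *: f) = L2oo_scale a (L2oo_class f).
Proof.
apply/L2oo_classP; apply: filterS (L2oo_class_ae f) => x fx.
by rewrite /= !fctE; congr (_ *: _); rewrite -fx.
Qed.

Let scaleA (a b : C) (f : A) :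
  L2oo_scale a (L2oo_scale b f) = L2oo_scale (a * b) f.
Proof.
by rewrite -[f]L2oo_reprK -!L2oo_scaleE scalerA.
Qed.

Let scale1 : left_id 1 L2oo_scale.
Proof. by move=> f; rewrite -[f]L2oo_reprK -!L2oo_scaleE scale1r. Qed.

Let scaleDr : right_distributive L2oo_scale +%R.
Proof.
move=> a f g; rewrite -[f]L2oo_reprK -[g]L2oo_reprK.
by rewrite -L2oo_addE -!L2oo_scaleE -L2oo_addE scalerDr.
Qed.

Let scaleDl (f : A) : {morph L2oo_scale^~ f : a b / a + b}.
Proof.
by move=> a b; rewrite -[f]L2oo_reprK -!L2oo_scaleE -L2oo_addE scalerDl.
Qed.

HB.instance Definition _ := GRing.Zmodule_isLmodule.Build C A
  scaleA scale1 scaleDr scaleDl.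

Lemma L2oo_bounded (f : T -> C) : f \in L2oo_pred mu ->
  exists2 K : R, 0 <= K & {ae mu, forall x, normc (f x) <= K}.
Proof.
move=> /set_mem[_ _ _]; rewrite /finite_norm unlock.
case: ifPn => [_ foo|]; last first.
  rewrite lt0e measure_ge0 andbT negbK => /eqP mu0 _.
  by exists 0 => //; exists setT; split.
exists (Num.max 0 (fine (ess_sup mu (abse \o (EFin \o (normc \o f)))))).
  by rewrite le_max lexx.
apply: filterS (ess_sup_ge mu (abse \o (EFin \o (normc \o f)))) => x.
rewrite le_max => /=; move: foo; case: (ess_sup _ _) => [r _|//|_].
  by rewrite lee_fin ger0_norm ?normc_ge0// => ->; rewrite orbT.
by rewrite leeNy_eq.
Qed.

Lemma L2oo_mul_subproof (f g : L2oo_fun mu) :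
  (fun x => f x * g x) \in L2oo_pred mu.
Proof.
have fL := L2oo_valP f; have gL := L2oo_valP g.
have [K K0 fK] := L2oo_bounded fL.
have [g2 goo] := L2oo_Lfun gL.
move: fL gL => /set_mem[mrf mif _ _] /set_mem[mrg mig _ _].
apply: (@L2oo_dom _ _ _ _ _ (K *: (normc \o g))).
- rewrite (_ : (fun _ => _) =
    (fun x => Re (f x) * Re (g x) - Im (f x) * Im (g x))).
    by apply: measurable_funB; apply: measurable_funM.
  by apply/funext => x; case: (f x) (g x) => ? ? [].
- rewrite (_ : (fun _ => _) =
    (fun x => Re (f x) * Im (g x) + Im (f x) * Re (g x))).
    by apply: measurable_funD; apply: measurable_funM.
  by apply/funext => x; case: (f x) (g x) => ? ? [].
- have [z L] := @Lfun_submod_closed _ _ _ mu _ (lee1n 2).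
  by rewrite -[X in X \in _]addr0; exact: L.
- have [z L] := @Lfun_submod_closed _ _ _ mu +oo%E (leey 1).
  by rewrite -[X in X \in _]addr0; exact: L.
- apply: filterS fK => x fxK; rewrite ComplexField.Normc.normcM fctE.
  by apply: ler_wpM2r => //; exact: normc_ge0.
Qed.

Lemma L2oo_conj_subproof (f : L2oo_fun mu) :
  (fun x => (f x)^*) \in L2oo_pred mu.
Proof.
have [f2 foo] := L2oo_Lfun (L2oo_valP f).
have /set_mem[mr mi _ _] := L2oo_valP f.
apply: (@L2oo_dom _ _ _ _ _ (normc \o f)) => //.
- rewrite (_ : (fun _ => _) = (fun x => Re (f x)))//.
  by apply/funext => x; case: (f x).
- rewrite (_ : (fun _ => _) = (fun x => - Im (f x))).
    exact: measurable_funN.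
  by apply/funext => x; case: (f x).
- apply: nearW => x /=; case: (f x) => a b /=.
  by rewrite sqrrN.
Qed.

Lemma L2oo_restr_subproof (I : set T) (mI : measurable I) (f : L2oo_fun mu) :
  (fun x => \1_I x * f x) \in L2oo_pred mu.
Proof.
have [f2 foo] := L2oo_Lfun (L2oo_valP f).
have /set_mem[mr mi _ _] := L2oo_valP f.
have E x : \1_I x * f x = if x \in I then f x else 0.
  by rewrite indicE; case: ifP => _; rewrite ?mul1r ?mul0r.
apply: (@L2oo_dom _ _ _ _ _ (normc \o f)) => //.
- rewrite (_ : (fun _ => _) = (fun x => \1_I x * Re (f x))).
    by apply: measurable_funM => //; exact: measurable_indic.
  apply/funext => x; rewrite E indicE.
  by case: ifP => _; rewrite ?mul1r ?mul0r.
- rewrite (_ : (fun _ => _) = (fun x => \1_I x * Im (f x))).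
    by apply: measurable_funM => //; exact: measurable_indic.
  apply/funext => x; rewrite E indicE.
  by case: ifP => _; rewrite ?mul1r ?mul0r.
- apply: nearW => x /=; rewrite E; case: ifP => // _.
  by rewrite ComplexField.Normc.normc0 normc_ge0.
Qed.

Definition L2oo_mul (f g : A) : A :=
  L2oo_class (L2ooFun (L2oo_mul_subproof (L2oo_repr f) (L2oo_repr g))).

Definition L2oo_conj (f : A) : A :=
  L2oo_class (L2ooFun (L2oo_conj_subproof (L2oo_repr f))).

Definition L2oo_restr (I : set T) (mI : measurable I) (f : A) : A :=
  L2oo_class (L2ooFun (L2oo_restr_subproof mI (L2oo_repr f))).

Lemma L2oo_addx (f g : A) : {ae mu, forall x, (f + g : A) x = f x + g x}.
Proof.
have -> : f + g = L2oo_class (L2oo_repr f + L2oo_repr g).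
  by rewrite L2oo_addE !L2oo_reprK.
exact: L2oo_class_ae.
Qed.

Lemma L2oo_scalex a (f : A) : {ae mu, forall x, (a *: f : A) x = a * f x}.
Proof. exact: L2oo_class_ae. Qed.

Lemma L2oo_mulx (f g : A) : {ae mu, forall x, L2oo_mul f g x = f x * g x}.
Proof. exact: L2oo_class_ae. Qed.

Lemma L2oo_conjx (f : A) : {ae mu, forall x, L2oo_conj f x = (f x)^*}.
Proof. exact: L2oo_class_ae. Qed.

Lemma L2oo_restrx (I : set T) (mI : measurable I) (f : A) :
  {ae mu, forall x, L2oo_restr mI f x = \1_I x * f x}.
Proof. exact: L2oo_class_ae. Qed.

Definition Cintegral (f : T -> C) : C :=
  Complex (Rintegral mu setT (Re \o f)) (Rintegral mu setT (Im \o f)).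

Definition L2oo_dot (f g : A) : C := Cintegral (fun x => (f x)^* * g x).

Definition L2oo_norm (f : A) : \bar R :=
  'N[mu]_+oo[EFin \o (normc \o f)]%E.

End L2oo_theory.

Arguments L2oo_mul {dd T R mu} f g.
Arguments L2oo_conj {dd T R mu} f.
Arguments L2oo_restr {dd T R mu} [I] mI f.
Arguments L2oo_dot {dd T R mu} f g.
Arguments L2oo_norm {dd T R mu} f.

Section quadratic_fock.
Context {dd : measure_display} {T : measurableType dd} {R : realType}.
Variable mu : {measure set T -> \bar R}.
Local Notation C := R[i].
Local Notation A := (L2oo mu).

Definition hdot (H : lmodType C) (b : {dot H for @Num.conj C}) (x y : H) : C :=
  b y x.

Definition lin_span (H : lmodType C) (S : set H) : set H :=
  [set x | exists n (a : 'I_n -> C) (v : 'I_n -> H),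
    (forall i, S (v i)) /\ x = \sum_(i < n) a i *: v i].

Record rswn_fock (c : R) := RswnFock {
  fock_space :> completeNormedModType C;
  fock_form : {dot fock_space for @Num.conj C};
  fock_normE : forall x : fock_space, `|x| ^+ 2 = hdot fock_form x x;

  fock_dom : set fock_space;
  fock_cre : A -> fock_space -> fock_space;
  fock_ann : A -> fock_space -> fock_space;
  fock_num : A -> fock_space -> fock_space;

  fock_dom_lin : forall (a : C) x y,
    fock_dom x -> fock_dom y -> fock_dom (a *: x + y);
  cre_dom : forall f x, fock_dom x -> fock_dom (fock_cre f x);
  ann_dom : forall f x, fock_dom x -> fock_dom (fock_ann f x);
  num_dom : forall f x, fock_dom x -> fock_dom (fock_num f x);
  cre_linr : forall f (a : C) x y, fock_dom x -> fock_dom y ->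
    fock_cre f (a *: x + y) = a *: fock_cre f x + fock_cre f y;
  ann_linr : forall f (a : C) x y, fock_dom x -> fock_dom y ->
    fock_ann f (a *: x + y) = a *: fock_ann f x + fock_ann f y;
  num_linr : forall f (a : C) x y, fock_dom x -> fock_dom y ->
    fock_num f (a *: x + y) = a *: fock_num f x + fock_num f y;

  cre_lin : forall (a : C) f g x, fock_dom x ->
    fock_cre (a *: f + g) x = a *: fock_cre f x + fock_cre g x;
  ann_antilin : forall (a : C) f g x, fock_dom x ->
    fock_ann (a *: f + g) x = a^* *: fock_ann f x + fock_ann g x;
  num_lin : forall (a : C) f g x, fock_dom x ->
    fock_num (a *: f + g) x = a *: fock_num f x + fock_num g x;

  cre_adj : forall f x y, fock_dom x -> fock_dom y ->
    hdot fock_form (fock_cre f x) y = hdot fock_form x (fock_ann f y);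
  num_adj : forall f x y, fock_dom x -> fock_dom y ->
    hdot fock_form (fock_num f x) y = hdot fock_form x (fock_num (L2oo_conj f) y);

  ann_cre : forall f g x, fock_dom x ->
    fock_ann f (fock_cre g x) - fock_cre g (fock_ann f x) =
    (2 * c%:C%C * L2oo_dot f g) *: x + 4 *: fock_num (L2oo_mul (L2oo_conj f) g) x;
  num_cre : forall a f x, fock_dom x ->
    fock_num a (fock_cre f x) - fock_cre f (fock_num a x) = 2 *: fock_cre (L2oo_mul a f) x;
  cre_cre : forall f g x, fock_dom x -> fock_cre f (fock_cre g x) = fock_cre g (fock_cre f x);
  ann_ann : forall f g x, fock_dom x -> fock_ann f (fock_ann g x) = fock_ann g (fock_ann f x);
  num_num : forall a b x, fock_dom x -> fock_num a (fock_num b x) = fock_num b (fock_num a x);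

  fock_vac : fock_space;
  vac_dom : fock_dom fock_vac;
  vac_unit : `|fock_vac| = 1;
  ann_vac : forall f, fock_ann f fock_vac = 0;
  num_vac : forall f, fock_num f fock_vac = 0;
  fock_total : closure (lin_span
    [set x | exists n f, x = iter n (fock_cre f) fock_vac]) = setT }.

Arguments fock_cre {c} F f x : rename.
Arguments fock_ann {c} F f x : rename.
Arguments fock_num {c} F f x : rename.
Arguments fock_vac {c} F : rename.

Section second_quantization.
Variables (c : R) (F : rswn_fock c).

Definition expvec (f : A) : F :=
  limn (series (fun n => (n`!%:R : C)^-1 *: iter n (fock_cre F f) (fock_vac F))).

Definition small (f : A) : Prop := (L2oo_norm f < (2^-1)%:E)%E.

Definition second_quantization (p : A -> A) (x y : F) : Prop :=
  exists n (a : 'I_n -> C) (f : 'I_n -> A),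
    [/\ forall i, small (f i),
        x = \sum_(i < n) a i *: expvec (f i) &
        y = \sum_(i < n) a i *: expvec (p (f i))].

Definition orthogonal_projection (P : {linear F -> F}) : Prop :=
  [/\ exists M : C, forall x, `|P x| <= M * `|x|,
      forall x, P (P x) = P x &
      forall x y, hdot (fock_form F) (P x) y = hdot (fock_form F) x (P y)].

Definition extends_to_orthogonal_projection (G : F -> F -> Prop) : Prop :=
  exists2 P : {linear F -> F}, orthogonal_projection P &
    forall x y, G x y -> P x = y.

End second_quantization.

End quadratic_fock.

Arguments fock_cre {dd T R mu c} F f x : rename.
Arguments fock_ann {dd T R mu c} F f x : rename.
Arguments fock_num {dd T R mu c} F f x : rename.
Arguments fock_vac {dd T R mu c} F : rename.
Arguments expvec {dd T R mu c} F f.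
Arguments small {dd T R mu} f.
Arguments second_quantization {dd T R mu c} F p x y.

(* Main.v *)
From HB Require Import structures.
Require Import Defs.
From mathcomp Require Import all_boot all_order all_algebra.
From mathcomp Require Import complex.
From mathcomp Require Import all_classical all_reals all_analysis.
From mathcomp Require Import measurable_realfun ess_sup_inf.
From mathcomp Require Import ring lra.

Set Implicit Arguments.
Unset Strict Implicit.
Unset Printing Implicit Defensive.

Import Order.TTheory GRing.Theory Num.Theory.
Import numFieldTopology.Exports numFieldNormedType.Exports.

Local Open Scope classical_set_scope.
Local Open Scope ring_scope.

(** Write [B_f] for the creation operator of [f] and [Phi] for the vacuum, so
    that [cre_iter f n] is [B_f ^ n Phi], and let [P] be the would-be projection
    extending the second quantization of [p].

    If [P] is an orthogonal projection, then replacing [f] by [t f] in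
    [P Psi(f) = Psi(p f)] and comparing the coefficients of the powers of [t]
    gives [P (B_f ^ n Phi) = B_(p f) ^ n Phi] ([projection_cre_iter]).  Only two
    degrees are needed.  Degree one says that [p] is an orthogonal projection
    for the L2 product, because [<B_f Phi, B_g Phi> = 2 c <f, g>].  Degree two,
    polarized, says that [P (B_f B_g Phi) = B_(p f) B_(p g) Phi].  Let [u] be in
    the range of [p] and [v] in its kernel.  Then [B_u B_u Phi] is in the range
    of [P] while [P] kills [B_v B_w Phi] for every [w]; since [<u, v> = 0], the
    formula for the inner product of these two vectors ([hdot_cre2]) reduces to
    [<u, conj u v w> = 0].  Taking [w = u u conj v] yields [u v = 0] almost
    everywhere ([range_kernel_disjoint]).  So for every [g] the functions [p g]
    and [g - p g] live on the supports of the range and of the kernel of [p],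
    which are disjoint, and [p] is the multiplication by the indicator of the
    first support; sigma-finiteness lets that support be described by
    countably many functions ([disjoint_projection_indicator]).

    Conversely, let [p] be the multiplication by the indicator of [I].  The
    vectors [B_h ^ n Phi] with [h] supported in [I] are orthogonal to every
    [B_g x] with [g] supported off [I], because the annihilator of [g] kills
    them; and [B_f ^ n Phi - B_(p f) ^ n Phi] is itself of the form [B_g x].
    Hence the orthogonal projection onto the complement of all these [B_g x]
    maps [Psi(f)] to [Psi(p f)] ([restr_projection]).

    Both directions need the exponential series to converge for every function
    of norm below [1/2].  The commutation relations express the norm of
    [B_f ^ n.+1 Phi] through that of [B_f ^ n Phi] and a mixed product, and a
    positivity argument ([hdot_cre_cre_iter_ge0]) bounds that product, so that
    the ratio of consecutive terms is asymptotically at most [2 M], where [M]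
    is an almost everywhere bound of [f] ([exp_term_ratio]).  The existence of
    orthogonal projections in a Hilbert space is [orth_projection]. *)

(** * Inner products compatible with the norm *)

Section inner_product.
Context {R : realType} {H : normedModType R[i]}.
Variable b : {dot H for @Num.conj R[i]}.
Hypothesis normE : forall x : H, `|x| ^+ 2 = hdot b x x.
Implicit Types (x y z k : H) (a : R[i]).

Lemma hdotDr x y z : hdot b x (y + z) = hdot b x y + hdot b x z.
Proof. exact: linearDl. Qed.

Lemma hdotZr x a y : hdot b x (a *: y) = a * hdot b x y.
Proof. exact: linearZl_LR. Qed.

Lemma hdotC x y : hdot b x y = (hdot b y x)^*.
Proof. by rewrite /hdot hermC expr0 mul1r. Qed.

Lemma hdotDl x y z : hdot b (x + y) z = hdot b x z + hdot b y z.
Proof. by rewrite hdotC hdotDr rmorphD/= -!hdotC. Qed.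

Lemma hdotZl x a y : hdot b (a *: x) y = a^* * hdot b x y.
Proof. by rewrite hdotC hdotZr rmorphM/= -hdotC. Qed.

Lemma hdot0r x : hdot b x 0 = 0.
Proof. by rewrite -[X in hdot b x X](scale0r x) hdotZr mul0r. Qed.

Lemma hdotNr x y : hdot b x (- y) = - hdot b x y.
Proof. by rewrite -scaleN1r hdotZr mulN1r. Qed.

Lemma hdotBr x y z : hdot b x (y - z) = hdot b x y - hdot b x z.
Proof. by rewrite hdotDr hdotNr. Qed.

Lemma hdotBl x y z : hdot b (x - y) z = hdot b x z - hdot b y z.
Proof. by rewrite hdotC hdotBr rmorphB/= -!hdotC. Qed.

Lemma hdot_ge0 x : 0 <= hdot b x x.
Proof. by rewrite -normE exprn_ge0. Qed.

Lemma hdot_eq0 x : hdot b x x = 0 -> x = 0.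
Proof. by rewrite -normE => /eqP; rewrite sqrf_eq0 normr_eq0 => /eqP. Qed.

Lemma hdot_dist x y :
  hdot b (x - y) (x - y) =
  hdot b x x - hdot b x y - (hdot b y x - hdot b y y).
Proof. by rewrite hdotBl !hdotBr. Qed.

(** A point [z] that almost minimizes the distance to a line of direction [k]
    is almost orthogonal to [k]: move along the line by the optimal amount
    [<k, z> / <k, k>].  With [m = 0] this is the Cauchy-Schwarz inequality; with
    [m] the squared distance to a subspace it gives the projection theorem. *)
Lemma near_minimizer (m : R[i]) k z :
  (forall a, m <= `|z - a *: k| ^+ 2) ->
  `|hdot b k z| ^+ 2 <= `|k| ^+ 2 * (`|z| ^+ 2 - m).
Proof.
move=> mle; have [->|k0] := eqVneq k 0.
  by rewrite hdotC hdot0r conjC0 !normr0 !expr0n/= mul0r.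
have kk : 0 < hdot b k k.
  by rewrite lt_def hdot_ge0 andbT; apply: contra_neq k0 => /hdot_eq0.
have := mle (hdot b k z / hdot b k k); rewrite !normE hdot_dist.
rewrite hdotZr hdotZl hdotZl hdotZr [hdot b z k]hdotC rmorphM/= fmorphV/=
  -[(hdot b k k)^*]hdotC.
rewrite normCK => {}mle.
rewrite -subr_ge0 -(pmulr_rge0 _ (_ : 0 < (hdot b k k)^-1)) ?invr_gt0//.
move: mle; rewrite -subr_ge0; congr (0 <= _); field.
by rewrite gt_eqF.
Qed.

Lemma cauchy_schwarz x y : `|hdot b x y| <= `|x| * `|y|.
Proof.
have := @near_minimizer 0 x y (fun=> exprn_ge0 2 (normr_ge0 _)).
rewrite subr0 -exprMn ler_pXn2r// nnegrE ?mulr_ge0//.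
Qed.

Lemma cvg_hdot (u : nat -> H) k y :
  u @ \oo --> y ->
  (fun n => hdot b k (u n) : R[i]^o) @ \oo --> (hdot b k y : R[i]^o).
Proof.
move=> uy; apply/cvgrPdist_lt => e e0.
have k1 : 0 < `|k| + 1 by rewrite ltr_wpDl.
move/cvgrPdist_lt : uy => /(_ _ (divr_gt0 e0 k1)); apply: filterS => n.
rewrite ltr_pdivlMr// -hdotBr mulrC; apply: le_lt_trans.
by rewrite (le_trans (cauchy_schwarz _ _))// ler_wpM2r// lerDl.
Qed.

End inner_product.

(** Limits in [H] are taken along complex radii, whereas the estimates come with
    real rates; this lemma and the next bridge the two. *)
Lemma cvg0_from_rate (R : realType) (H : normedModType R[i])
    (u : nat -> H) (r : nat -> R) :
  r @ \oo --> 0 -> (forall n, `|u n| <= (r n)%:C%C) -> u @ \oo --> 0.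
Proof.
move=> r0 ur; apply/cvgrPdist_lt => e e0.
have eE : e = (complex.Re e)%:C%C by rewrite RRe_real// gtr0_real.
have Re0 : 0 < complex.Re e by rewrite -ltcR -eE.
move/cvgrPdist_lt : r0 => /(_ _ Re0); apply: filterS => n.
rewrite sub0r normrN => /(le_lt_trans (ler_norm _)) rn.
by rewrite sub0r normrN (le_lt_trans (ur n))// eE ltcR.
Qed.

Lemma cvg_from_rate (R : realType) (H : completeNormedModType R[i])
    (u : nat -> H) (r : nat -> R) :
  r @ \oo --> 0 ->
  (forall m n, (m <= n)%N -> `|u n - u m| <= (r m)%:C%C) ->
  cvgn u.
Proof.
move=> r0 ur; apply/cauchy_cvgP/cauchy_ballP => e e0; rewrite near_map2.
have eE : e = (complex.Re e)%:C%C by rewrite RRe_real// gtr0_real.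
have Re0 : 0 < complex.Re e / 2.
  by rewrite divr_gt0//; move: e0; rewrite eE ltcR.
move/cvgrPdist_lt : r0 => /(_ _ Re0) [N _ rN].
have uN n : (N <= n)%N -> `|u n - u N| < e / 2.
  move=> Nn; rewrite (le_lt_trans (ur _ _ Nn))//.
  have := rN N (leqnn _); rewrite /= sub0r normrN =>
    /(le_lt_trans (ler_norm _)).
  by rewrite -ltcR rmorphM fmorphV/= -eE rmorph_nat.
exists ([set n | (N <= n)%N], [set n | (N <= n)%N]) => /=.
  by split; exists N.
move=> [m n] [/= Nm Nn]; rewrite -ball_normE/= (splitr e).
by rewrite (le_lt_trans (ler_distD (u N) _ _))// ltrD ?uN// distrC uN.
Qed.

(** * Projection onto an orthogonal complement *)

Section orthogonal_complement.
Context {R : realType} {H : completeNormedModType R[i]}.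
Variable b : {dot H for @Num.conj R[i]}.
Hypothesis normE : forall x : H, `|x| ^+ 2 = hdot b x x.
Implicit Types (S : set H) (x y z k : H) (a : R[i]).

(** Only subspaces of this form are projected onto: they are closed, so no
    closure has to be taken. *)
Definition orth S : set H := [set y | forall s, S s -> hdot b s y = 0].

Lemma orth_comb S a x y : orth S x -> orth S y -> orth S (a *: x + y).
Proof.
by move=> Sx Sy s Ss; rewrite hdotDr hdotZr Sx// Sy// mulr0 addr0.
Qed.

Lemma orth0 S : orth S 0.
Proof. by move=> s _; rewrite hdot0r. Qed.

Lemma orthB S x y : orth S x -> orth S y -> orth S (x - y).
Proof. by move=> Sx Sy; rewrite addrC -scaleN1r; exact: orth_comb. Qed.

Lemma orth_cvg S (u : nat -> H) y :
  u @ \oo --> y -> (forall n, orth S (u n)) -> orth S y.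
Proof.
move=> uy Su s Ss; apply: (cvg_unique _ (cvg_hdot normE (k := s) uy)) => //.
rewrite (_ : (fun _ => _) = cst 0); first exact: cvg_cst.
by apply/funext => n; exact: Su.
Qed.

Lemma parallelogram x y z :
  `|y - z| ^+ 2 = 2 * `|x - y| ^+ 2 + 2 * `|x - z| ^+ 2
                  - 4 * `|x - (2^-1 *: y + 2^-1 *: z)| ^+ 2.
Proof.
rewrite !normE !hdot_dist !(hdotDl, hdotDr) !hdotZl !hdotZr.
by rewrite fmorphV rmorph_nat; field.
Qed.

(** A minimizing sequence for the distance from [x] to [orth S] is Cauchy by the
    parallelogram law, and the differences to [x] become orthogonal to [orth S]
    by [near_minimizer]. *)
Lemma orth_decomposition S x :
  exists2 y, orth S y & forall k, orth S k -> hdot b k (x - y) = 0.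
Proof.
pose nr (y : H) : R := complex.Re (`|y| ^+ 2).
have nrE y : (nr y)%:C%C = `|y| ^+ 2 by rewrite RRe_real ?ger0_real ?exprn_ge0.
have nr0 y : 0 <= nr y by rewrite -lecR nrE exprn_ge0.
pose D : set R := [set nr (x - y) | y in orth S].
have D0 : D !=set0 by exists (nr (x - 0)), 0; [exact: orth0|].
have Dlb : lbound D 0 by move=> _ [y _ <-].
have Dinf : has_inf D by split=> //; exists 0.
pose m := inf D.
have mle y : orth S y -> m%:C%C <= `|x - y| ^+ 2.
  by move=> Sy; rewrite -nrE lecR; apply: ge_inf; [exists 0|exists y].
have mapp (n : nat) : exists y,
    orth S y /\ `|x - y| ^+ 2 <= (m + n.+1%:R^-1 ^+ 2)%:C%C.
  have e0 : 0 < (n.+1%:R^-1 : R) ^+ 2 by rewrite exprn_gt0// invr_gt0 ltr0n.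
  have [_ [y Sy <-] lty] := inf_adherent e0 Dinf.
  by exists y; split=> //; rewrite -nrE lecR ltW.
have [u uP] := choice mapp.
have uS n : orth S (u n) := (uP n).1.
have orthu k n : orth S k -> `|hdot b k (x - u n)| <= (n.+1%:R^-1)%:C%C * `|k|.
  move=> Sk.
  have inv0 : 0 <= (n.+1%:R^-1 : R)%:C%C by rewrite lecR invr_ge0.
  rewrite -(@ler_pXn2r _ 2)// ?nnegrE ?mulr_ge0//.
  rewrite (le_trans (near_minimizer normE (m := m%:C%C) _))//.
    by move=> a; rewrite -addrA -opprD; apply: mle; rewrite addrC;
      exact: orth_comb.
  rewrite exprMn mulrC ler_wpM2r ?exprn_ge0// lerBlDl (le_trans (uP n).2)//.
  by rewrite rmorphD rmorphXn.
have cu : cvgn u.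
  apply: (@cvg_from_rate _ _ _ (fun n => 2 * n.+1%:R^-1)).
    rewrite -[X in _ --> X](mulr0 2); apply: cvgM; first exact: cvg_cst.
    exact: cvg_harmonic.
  move=> i j ij; rewrite -(@ler_pXn2r _ 2)//
    ?nnegrE ?lecR ?mulr_ge0 ?invr_ge0//.
  have Smid : orth S (2^-1 *: u j + 2^-1 *: u i).
    apply: orth_comb => //; rewrite -[_ *: _]addr0; apply: orth_comb => //;
      exact: orth0.
  rewrite (parallelogram x).
  have vj : `|x - u j| ^+ 2 <= (m + i.+1%:R^-1 ^+ 2)%:C%C.
    rewrite (le_trans (uP j).2)// lecR lerD2l ler_pXn2r ?nnegrE ?invr_ge0//.
    by rewrite lef_pV2 ?posrE ?ltr0n// ler_nat.
  have vi := (uP i).2; have := mle _ Smid.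
  rewrite rmorphM rmorph_nat exprMn /=.
  move: vi vj; rewrite rmorphD rmorphXn/=.
  move: (`|x - u i| ^+ 2) (`|x - u j| ^+ 2) (`|x - (_ + _)| ^+ 2) => A B C0.
  move=> hA hB hC.
  set e := _ ^+ 2 in hA hB *.
  have -> : 2 ^+ 2 * e =
      2 * (m%:C%C + e) + 2 * (m%:C%C + e) - 4 * m%:C%C by ring.
  by apply: lerB; [apply: lerD|]; rewrite ler_wpM2l.
exists (limn u); first exact: orth_cvg cu uS.
move=> k Sk.
apply: (cvg_unique _ (F := (fun n => hdot b k (x - u n) : R[i]^o) @ \oo)) => //.
  by apply: cvg_hdot => //; apply: cvgB => //; exact: cvg_cst.
apply: (@cvg0_from_rate _ _ _ (fun n => n.+1%:R^-1 * complex.Re `|k|)).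
  rewrite -[X in _ --> X](mul0r (complex.Re `|k|)); apply: cvgM;
    last exact: cvg_cst.
  exact: cvg_harmonic.
move=> n; rewrite rmorphM [X in _ <= _ * X]RRe_real ?normr_real//.
exact: orthu.
Qed.

(** The first clause is the form in which the value of [P] at a given point is
    computed later. *)
Lemma orth_projection S : exists P : {linear H -> H},
  [/\ forall x y, orth S y ->
        (forall k, orth S k -> hdot b k (x - y) = 0) -> P x = y,
      forall x, `|P x| <= `|x|,
      forall x, P (P x) = P x &
      forall x y, hdot b (P x) y = hdot b x (P y)].
Proof.
have decomp x : exists y,
    orth S y /\ forall k, orth S k -> hdot b k (x - y) = 0.
  by have [y ? ?] := orth_decomposition S x; exists y.
have [P PP] := choice decomp.
have P_uniq x y : orth S y ->
    (forall k, orth S k -> hdot b k (x - y) = 0) -> P x = y.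
  move=> Sy xy; apply/eqP; rewrite -subr_eq0; apply/eqP/(hdot_eq0 normE).
  have Sd : orth S (P x - y) by apply: orthB => //; exact: (PP x).1.
  have -> : hdot b (P x - y) (P x - y) = hdot b (P x - y) ((x - y) - (x - P x)).
    by congr hdot; rewrite opprB [in RHS]addrC addrA subrK.
  by rewrite hdotBr xy// (PP x).2// subrr.
have P_lin : linear P.
  move=> a x y; apply: P_uniq.
    by apply: orth_comb; [exact: (PP x).1|exact: (PP y).1].
  move=> k Sk; rewrite opprD addrACA -scalerBr hdotDr hdotZr.
  by rewrite !(PP _).2// mulr0 addr0.
pose Pl : {linear H -> H} := HB.pack P (GRing.isLinear.Build _ _ _ _ P P_lin).
have orthP x k : orth S k -> hdot b k (x - P x) = 0 by exact: (PP x).2.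
exists Pl; split => //=.
- move=> x; rewrite -(@ler_pXn2r _ 2)// ?nnegrE// !normE.
  have := orthP x _ (PP x).1; move: (subrK (P x) x); set d := x - P x.
  clearbody d => xE Pd; rewrite -{3 4}xE hdotDr !hdotDl [hdot b d (P x)]hdotC Pd
    conjC0.
  by rewrite addr0 add0r lerDr (hdot_ge0 normE).
- move=> x; apply: P_uniq; first exact: (PP x).1.
  by move=> k _; rewrite subrr hdot0r.
- move=> x y.
  have := orthP y _ (PP x).1; have := orthP x _ (PP y).1.
  rewrite !hdotBr => /eqP; rewrite subr_eq0 => /eqP xy /eqP;
    rewrite subr_eq0 => /eqP ->.
  by rewrite hdotC -xy -hdotC.
Qed.

End orthogonal_complement.

(** * Series dominated by geometric ones *)

Section vector_series.
Context {R : realType}.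

Lemma eventually_geometric (u : nat -> R) (s : R) :
  0 < s -> (exists N, forall n, (N <= n)%N -> u n.+1 <= s * u n) ->
  exists K, forall n, u n <= K * s ^+ n.
Proof.
move=> s0 [N]; elim: N u => [|N IH] u uN.
  exists (u 0%N); elim=> [|n IHn]; first by rewrite mulr1.
  by rewrite (le_trans (uN n _))// exprS mulrCA ler_pM2l.
have [|K uK] := IH (fun n => u n.+1); first by move=> n Nn; exact: uN.
exists (Num.max (u 0%N) (K / s)) => -[|n].
  by rewrite mulr1 le_max lexx.
rewrite (le_trans (uK n))// exprS mulrA ler_wpM2r ?exprn_ge0 ?(ltW s0)//.
by rewrite -ler_pdivrMr// le_max lexx orbT.
Qed.

Lemma cvg_series_geometric (H : completeNormedModType R[i]) (u : nat ->
  H) (K s : R) :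
  0 < s < 1 -> (forall n, `|u n| <= (K * s ^+ n)%:C%C) -> cvgn (series u).
Proof.
move=> /andP[s0 s1] uK; have s1' : 0 < 1 - s by rewrite subr_gt0.
have K0 : 0 <= K by have := le_trans (normr_ge0 _) (uK 0%N); rewrite mulr1 lecR.
apply: (@cvg_from_rate _ _ _ (fun m => K / (1 - s) * s ^+ m)).
  rewrite -[X in _ --> X](mulr0 (K / (1 - s))); apply: cvgM;
    first exact: cvg_cst.
  by apply: cvg_expr; rewrite ger0_norm// ltW.
move=> m n /subnK <-; move: (n - m)%N => j.
(* This sharper bound telescopes. *)
suff : `|series u (j + m)%N - series u m| <=
    (K / (1 - s) * (s ^+ m - s ^+ (j + m)))%:C%C.
  move=> /le_trans; apply; rewrite lecR ler_wpM2l ?divr_ge0 ?(ltW s1')//.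
  by rewrite gerBl exprn_ge0// ltW.
elim: j => [|j IH]; first by rewrite !subrr normr0 mulr0.
rewrite addSn seriesSr addrAC (le_trans (ler_normD _ _))//.
rewrite (le_trans (lerD IH (uK _)))// -rmorphD lecR.
rewrite le_eqVlt; apply/orP; left; apply/eqP; rewrite exprS; field.
by rewrite gt_eqF.
Qed.

(** Once the coefficients below [n] vanish, the sum of the series differs from
    [t ^+ n *: y n] by at most [2 K t ^+ n.+1] when [t <= 1/2]; divide by
    [t ^+ n] and let [t] tend to [0]. *)
Lemma power_series_eq0 (H : normedModType R[i]) (y : nat -> H) (K : R) :
  (forall n, `|y n| <= K%:C%C) ->
  (forall t : R, 0 < t <= 1 ->
    series (fun n => (t ^+ n)%:C%C *: y n) @ \oo --> (0 : H)) ->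
  forall n, y n = 0.
Proof.
move=> yK y0 n.
have K0 : 0 <= K by have := le_trans (normr_ge0 _) (yK 0%N); rewrite lecR.
elim/ltn_ind: n => n IH.
(* The factor [2 * (1 - 2^-1 ^+ j)] is a partial sum of the geometric series of
   ratio [1/2], which dominates the powers of [t]. *)
have bound (t : R) : 0 < t <= 2^-1 -> forall j,
    `|series (fun n => (t ^+ n)%:C%C *: y n) (j + n.+1)%N
      - (t ^+ n)%:C%C *: y n| <= (K * t ^+ n.+1 * (2 * (1 - 2^-1 ^+ j)))%:C%C.
  move=> /andP[t0 t2]; have t0' := ltW t0; elim=> [|j IHj].
    rewrite seriesSr /series/= big_nat big1 ?add0r ?subrr ?normr0 ?mulr0//.
    by move=> k /andP[_ kn]; rewrite IH// scaler0.
  rewrite addSn seriesSr addrAC (le_trans (ler_normD _ _))//.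
  rewrite normrZ ger0_norm ?lecR ?exprn_ge0 //.
  have tk : 0 <= t ^+ (j + n.+1) by rewrite exprn_ge0 // ltW.
  have tk' : (t ^+ (j + n.+1))%:C%C * `|y (j + n.+1)%N| <=
      (K * t ^+ n.+1 * 2^-1 ^+ j)%:C%C.
    rewrite mulrC (le_trans (ler_pM _ _ (yK _) (lexx _)))// ?lecR//
      -rmorphM lecR.
    rewrite -mulrA ler_wpM2l// addnC exprD ler_wpM2l// ?exprn_ge0 //.
    by rewrite lerXn2r// nnegrE// invr_ge0.
  rewrite (le_trans (lerD IHj tk'))//
    -rmorphD lecR -mulrDr ler_wpM2l ?mulr_ge0 ?exprn_ge0 //.
  by rewrite le_eqVlt; apply/orP; left; apply/eqP; rewrite exprS; field.
have small_t (t : R) : 0 < t <= 2^-1 -> `|y n| <= (2 * K * t)%:C%C.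
  move=> t02; have /andP[t0 t2] := t02; have t0' := ltW t0.
  have tn : 0 < (t ^+ n)%:C%C by rewrite ltcR exprn_gt0.
  rewrite -(ler_pM2l tn) -[X in X * _](ger0_norm (ltW tn)) -normrZ.
  apply/ler_addgt0Pr => e e0.
  have t1 : 0 < t <= 1 by rewrite t0 (le_trans t2)// invf_le1// ler1n.
  move/cvgrPdist_lt : (y0 t t1) => /(_ _ e0) [N _].
  move=> /(_ (N + n.+1)%N (leq_addr _ _)) /=.
  rewrite sub0r normrN => SN.
  have := bound t t02 N; set S := series _ _ in SN *; set z := _ *: y n => bN.
  rewrite -[z](subKr S) (le_trans (ler_normB _ _))// addrC lerD// ?(ltW SN)//.
  rewrite (le_trans bN)// -rmorphM lecR exprS.
  have -> : t ^+ n * (2 * K * t) = K * (t * t ^+ n) * 2 by ring.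
  rewrite ler_wpM2l ?mulr_ge0 ?exprn_ge0// ler_piMr// gerBl exprn_ge0//.
apply/eqP; rewrite -normr_le0.
have yE : `|y n| = (complex.Re `|y n|)%:C%C by rewrite RRe_real ?normr_real.
rewrite yE lecR; apply/ler_addgt0Pr => e e0; rewrite add0r -lecR -yE.
have [K00|K1] := leP K 0.
  have K00' : K = 0 by apply/le_anti; rewrite K00.
  have := small_t 2^-1; rewrite K00' mulr0 mul0r lexx andbT invr_gt0 ltr0n =>
    /(_ isT) /le_trans; apply.
  by rewrite lecR ltW.
have K2 : 0 < 2 * K by rewrite mulr_gt0.
rewrite (le_trans (small_t (Num.min 2^-1 (e / (2 * K))) _))//.
  by rewrite lt_min invr_gt0 ltr0n divr_gt0//= ge_min lexx.
by rewrite lecR mulrC -ler_pdivlMr// ge_min lexx orbT.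
Qed.

End vector_series.

(** * The algebra of square integrable bounded functions *)

Section L2oo_calculus.
Context {dd : measure_display} {T : measurableType dd} {R : realType}.
Variable mu : {measure set T -> \bar R}.
Local Notation A := (L2oo mu).
Local Notation normc := (@ComplexField.Normc.normc R).
Implicit Types (f g h u v : A).

Lemma L2oo_eq0 f : {ae mu, forall x, f x = 0} -> f = 0.
Proof.
move=> f0; rewrite -(subrr f); apply/L2ooP.
have e := L2oo_addx f (- f); have := L2oo_scalex (-1) f; rewrite scaleN1r.
move=> e'; apply: filterS3 e e' f0 => x -> -> ->.
by rewrite mulr0 addr0.
Qed.

Lemma L2oo_0x : {ae mu, forall x, (0 : A) x = 0}.
Proof.
have := L2oo_scalex 0 (0 : A); rewrite scale0r.
by apply: filterS => x ->; rewrite mul0r.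
Qed.

Lemma L2oo_subx f g : {ae mu, forall x, (f - g : A) x = f x - g x}.
Proof.
have := L2oo_scalex (-1) g; rewrite scaleN1r.
by apply: filterS2 (L2oo_addx f (- g)) => x -> ->; rewrite mulN1r.
Qed.

Lemma measurable_Re_Im (F : L2oo_fun mu) :
  measurable_fun setT (@complex.Re R \o F) /\
    measurable_fun setT (@complex.Im R \o F).
Proof. by have /set_mem[? ?] := L2oo_valP F. Qed.

(** The integrand of [L2oo_dot], packaged to inherit measurability. *)
Definition dot_integrand f g : L2oo_fun mu :=
  L2ooFun (L2oo_mul_subproof (L2ooFun (L2oo_conj_subproof (L2oo_repr f)))
    (L2oo_repr g)).

Lemma L2oo_dot_ae f g f' g' :
  {ae mu, forall x, (f x)^* * g x = (f' x)^* * g' x} ->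
  L2oo_dot f g = L2oo_dot f' g'.
Proof.
move=> e; have [mr mi] := measurable_Re_Im (dot_integrand f g).
have [mr' mi'] := measurable_Re_Im (dot_integrand f' g').
rewrite /L2oo_dot /Cintegral /Rintegral; congr Complex; congr fine;
  apply: ae_eq_integral => //; try exact/measurable_EFinP;
  by apply: filterS e => x /= ->.
Qed.

Lemma L2oo_dot_ae0 f g :
  {ae mu, forall x, (f x)^* * g x = 0} -> L2oo_dot f g = 0.
Proof.
move=> e; have [mr mi] := measurable_Re_Im (dot_integrand f g).
have int0 (u : T -> R) : measurable_fun setT u -> {ae mu, forall x, u x = 0} ->
    Rintegral mu setT u = 0.
  move=> mu_ u0; rewrite /Rintegral (_ : integral _ _ _ = 0)//.
  rewrite -(integral0 mu setT); apply: ae_eq_integral => //;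
    first exact/measurable_EFinP.
  by apply: filterS u0 => x /= ->.
by rewrite /L2oo_dot /Cintegral !int0//; apply: filterS e => x /= ->.
Qed.

Lemma L2oo_dot_ge0 f g :
  {ae mu, forall x, 0 <= (f x)^* * g x} -> 0 <= L2oo_dot f g.
Proof.
move=> e; have [mr mi] := measurable_Re_Im (dot_integrand f g).
rewrite lecE /=; apply/andP; split.
  rewrite /Rintegral (_ : integral _ _ _ = 0)//.
  rewrite -(integral0 mu setT); apply: ae_eq_integral => //;
    first exact/measurable_EFinP.
  by apply: filterS e => x /=; rewrite lecE/= => /andP[/eqP ->].
rewrite /Rintegral.
rewrite (_ : integral _ _ _ =
    (\int[mu]_x (`|complex.Re ((f x)^* * g x)|)%:E)%E).
  by apply: fine_ge0; apply: integral_ge0 => x _; rewrite lee_fin.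
apply: ae_eq_integral => //; try exact/measurable_EFinP.
  by apply/measurable_EFinP; exact: measurableT_comp.
by apply: filterS e => x /=; rewrite lecE/= => /andP[_ /ger0_norm ->].
Qed.

Lemma normc_conj_mul (z : R[i]) : z^* * z = ((normc z) ^+ 2)%:C%C.
Proof. by rewrite mulrC -normCK rmorphXn. Qed.

Lemma L2oo_dot_eq0 f : L2oo_dot f f = 0 -> f = 0.
Proof.
move=> ff0; apply: L2oo_eq0.
have [f2 _] := L2oo_Lfun (L2oo_valP (L2oo_repr f)).
have int := Lfun2_integrable_sqr f2.
have : (\int[mu]_x `|((normc (f x)) ^+ 2)%:E| = 0)%E.
  transitivity (\int[mu]_x ((normc (f x)) ^+ 2)%:E)%E.
    by apply: eq_integral => x _; rewrite gee0_abs// lee_fin sqr_ge0.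
  rewrite -(fineK (integrable_fin_num _ int))//; congr EFin.
  move: ff0 => /(congr1 (@complex.Re R)) /= <-.
  rewrite /Rintegral; congr fine; apply: eq_integral => x _ /=.
  by rewrite normc_conj_mul.
have mint := measurable_int _ int.
move=> /(ae_eq_integral_abs mu measurableT mint);
  apply: filterS => x /= /(_ I) [] /eqP.
by rewrite sqrf_eq0 => /eqP/ComplexField.Normc.eq0_normc.
Qed.

Lemma small_bound f : small f ->
  exists M : R, [/\ 0 <= M, M < 2^-1 & {ae mu, forall x, normc (f x) <= M}].
Proof.
rewrite /small /L2oo_norm unlock; case: ifPn => [_|].
  set s := ess_sup _ _ => s2.
  exists (Num.max 0 (fine s)); split.
  - by rewrite le_max lexx.
  - rewrite gt_max invr_gt0 ltr0n/=; move: s2.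
    by case: s => [r||]//=; rewrite ?lte_fin// invr_gt0.
  - have := ess_sup_ge mu (abse \o (EFin \o (normc \o f))).
    apply: filterS => x; rewrite -/s le_max /=.
    move: s2; case: s => [r _|//|_].
      by rewrite lee_fin ger0_norm ?normc_ge0// => ->; rewrite orbT.
    by rewrite leeNy_eq.
rewrite lt0e measure_ge0 andbT negbK => /eqP mu0 _.
exists 0; split; rewrite ?invr_gt0//.
by exists setT; split.
Qed.

Lemma bound_small f (M : R) : M < 2^-1 ->
  {ae mu, forall x, normc (f x) <= M} -> small f.
Proof.
move=> M2 fM; rewrite /small /L2oo_norm unlock; case: ifPn => _;
  last by rewrite lte_fin invr_gt0.
apply: le_lt_trans (_ : M%:E < _)%E; last by rewrite lte_fin.
apply/ess_supP; apply: filterS fM => x /=.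
by rewrite lee_fin ger0_norm ?normc_ge0.
Qed.

Lemma small_shrink f (t : R) : 0 < t <= 1 -> small f -> small (t%:C%C *: f).
Proof.
move=> /andP[t0 t1] /small_bound[M [M0 M2 fM]]; apply: (bound_small M2).
have tf := L2oo_scalex t%:C%C f; apply: filterS2 tf fM => x -> fxM.
rewrite ComplexField.Normc.normcM /= expr0n/=
  addr0 sqrtr_sqr ger0_norm ?(ltW t0)//.
by rewrite -[M]mul1r ler_pM ?normc_ge0 ?(ltW t0).
Qed.

Lemma small_scale f : exists2 t : R, 0 < t & small (t%:C%C *: f).
Proof.
have [K K0 fK] := L2oo_bounded (L2oo_valP (L2oo_repr f)).
have t0 : 0 < (4 * (K + 1))^-1 by rewrite invr_gt0 mulr_gt0// ltr_wpDl.
(* This scaling brings the bound [K] below [1/4]. *)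
exists (4 * (K + 1))^-1 => //; apply: (bound_small (M := 4^-1));
  first by rewrite ltf_pV2 ?posrE// ltr_nat.
have tf := L2oo_scalex (4 * (K + 1))^-1%:C%C f.
apply: filterS2 tf fK => x -> fxK.
rewrite ComplexField.Normc.normcM /= expr0n/=
  addr0 sqrtr_sqr ger0_norm ?(ltW t0)//.
have K1 : 0 < K + 1 by rewrite ltr_wpDl.
rewrite invfM -mulrA ler_piMr ?invr_ge0// ler_pdivrMl// mulr1.
by rewrite (le_trans fxK)// lerDl.
Qed.

Lemma indic_subproof (E : set T) (mE : measurable E) (Ey : (mu E < +oo)%E) :
  (fun x => \1_E x : R[i]) \in L2oo_pred mu.
Proof.
have cE x : (\1_E x : R[i]) = (\1_E x : R)%:C%C.
  by rewrite !indicE; case: (x \in E).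
have nE : normc \o (fun x => \1_E x : R[i]) = (fun x => \1_E x : R).
  apply/funext => x /=; rewrite cE /= expr0n/= addr0 sqrtr_sqr ger0_norm//.
apply/mem_set; split; rewrite ?nE.
- rewrite (_ : (fun _ => _) = (\1_E : T -> R)); first exact: measurable_indic.
  by apply/funext => x; rewrite cE.
- rewrite (_ : (fun _ => _) = cst 0)//.
  by apply/funext => x; rewrite cE.
- rewrite /finite_norm unlock/= poweR_lty//.
  rewrite (_ : integral _ _ _ = mu E)//.
  rewrite -[in RHS](setIT E) -integral_indic//; apply: eq_integral => x _.
  by rewrite indicE; case: (x \in E); rewrite ?normr1 ?normr0 ?powR1 ?powR0.
- rewrite /finite_norm unlock; case: ifPn => // _.
  apply: le_lt_trans (ltry 1); apply/ess_supP; apply: nearW => x /=.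
  by rewrite lee_fin indicE; case: (x \in E); rewrite ?normr1 ?normr0.
Qed.

Definition L2oo_indic (E : set T) (mE : measurable E)
    (Ey : (mu E < +oo)%E) : A :=
  L2oo_class (L2ooFun (indic_subproof mE Ey)).

End L2oo_calculus.

(** * Inner products of states created from the vacuum *)

Section fock_vectors.
Context {dd : measure_display} {T : measurableType dd} {R : realType}.
Context {mu : {measure set T -> \bar R}} {c : R}.
Variable F : rswn_fock mu c.
Local Notation A := (L2oo mu).
Local Notation normc := (@ComplexField.Normc.normc R).
Local Notation Phi := (fock_vac F).
Local Notation "'<<' x , y '>>'" := (hdot (fock_form F) x y).
Implicit Types (f g h u v : A) (n m : nat) (x y : F).

Let nE := fun x : F => fock_normE x.

Definition cre_iter f n : F := iter n (fock_cre F f) Phi.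

Lemma cre_iter_dom f n : fock_dom (cre_iter f n).
Proof. by elim: n => [|n IH]; [exact: vac_dom|exact: cre_dom]. Qed.
#[local] Hint Extern 0 (fock_dom _) =>
  solve [repeat first [exact: cre_iter_dom | exact: vac_dom | apply: cre_dom]]
  : core.

Lemma dom0 : fock_dom (0 : F).
Proof.
rewrite -(addNr Phi) -scaleN1r; exact: fock_dom_lin.
Qed.

Lemma cre0r f : fock_cre F f 0 = 0.
Proof.
have := cre_linr f (-1) dom0 dom0.
by rewrite scaler0 addr0 scaleN1r addNr.
Qed.

Lemma cre_comb f (a a' : R[i]) x y : fock_dom x -> fock_dom y ->
  fock_cre F f (a *: x + a' *: y) = a *: fock_cre F f x + a' *: fock_cre F f y.
Proof.
move=> dx dy.
have dy' : fock_dom (a' *: y).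
  by rewrite -[_ *: _]addr0; apply: fock_dom_lin => //; exact: dom0.
rewrite cre_linr//; congr (_ + _).
by rewrite -[a' *: y]addr0 cre_linr ?cre0r ?addr0//; exact: dom0.
Qed.

Lemma creZ f (a : R[i]) x : fock_dom x ->
  fock_cre F f (a *: x) = a *: fock_cre F f x.
Proof. by move=> dx; have := cre_comb f a 0 dx dx; rewrite !scale0r !addr0. Qed.

Lemma cre0l x : fock_dom x -> fock_cre F 0 x = 0.
Proof.
by move=> dx; have := cre_lin (-1) 0 0 dx; rewrite scaler0 addr0 scaleN1r addNr.
Qed.

Lemma creZl (a : R[i]) f x : fock_dom x ->
  fock_cre F (a *: f) x = a *: fock_cre F f x.
Proof. by move=> dx; rewrite -[a *: f]addr0 cre_lin// cre0l// addr0. Qed.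

Lemma creDl f g x : fock_dom x ->
  fock_cre F (f + g) x = fock_cre F f x + fock_cre F g x.
Proof. by move=> dx; rewrite -[f]scale1r cre_lin// !scale1r. Qed.

Lemma creBl f g x : fock_dom x ->
  fock_cre F (f - g) x = fock_cre F f x - fock_cre F g x.
Proof. by move=> dx; rewrite creDl// -scaleN1r creZl// scaleN1r. Qed.

Lemma num_cre_iter a g n : fock_num F a (cre_iter g n.+1) =
  (2 * n.+1%:R) *: fock_cre F (L2oo_mul a g) (cre_iter g n).
Proof.
elim: n => [|n IH].
  have := num_cre a g (vac_dom F); rewrite num_vac cre0r subr0 => ->.
  by rewrite mulr1.
have := num_cre a g (cre_iter_dom g n.+1) => /eqP; rewrite subr_eq => /eqP /= e.
rewrite [LHS]e IH creZ// cre_cre// -scalerDl; congr (_ *: _).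
by rewrite -[in RHS]natr1; ring.
Qed.

(** Moving the annihilator to the right across the [n.+1] creators, each
    commutator contributes a scalar and a number operator, and the number
    operator [N_a], in front of [k] creators, contributes [2 k] times the state
    in which one [B_g] is replaced by [B_(a g)]; the number of scalars is
    [n.+1] and the sum of the [k] is [n.+1 * n / 2].  For [n = 0] the
    value of [n.-1] is immaterial since the coefficient vanishes. *)
Lemma ann_cre_iter f g n : fock_ann F f (cre_iter g n.+1) =
  (2 * c%:C%C * n.+1%:R * L2oo_dot f g) *: cre_iter g n +
  (4 * n.+1%:R * n%:R) *:
    fock_cre F (L2oo_mul (L2oo_mul (L2oo_conj f) g) g) (cre_iter g n.-1).
Proof.
elim: n => [|n IH].
  have := ann_cre f g (vac_dom F); rewrite ann_vac cre0r subr0 num_vac => ->.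
  by rewrite mulr0 scale0r scaler0 mulr1.
have := ann_cre f g (cre_iter_dom g n.+1) => /eqP; rewrite subr_eq => /eqP /= e.
rewrite [LHS]e IH num_cre_iter cre_comb//.
set h := L2oo_mul _ _.
have -> :
    (4 * n.+1%:R * n%:R) *: fock_cre F g (fock_cre F h (cre_iter g n.-1)) =
    (4 * n.+1%:R * n%:R : R[i]) *: fock_cre F h (cre_iter g n).
  by case: n {IH e} => [|n]; [rewrite mulr0 !scale0r|rewrite cre_cre].
rewrite scalerA addrACA -!scalerDl.
by congr (_ *: _ + _ *: _); rewrite -[n.+2%:R]natr1 -[n.+1%:R]natr1; ring.
Qed.

Lemma hdot_vac : << Phi, Phi >> = 1.
Proof. by rewrite -nE vac_unit expr1n. Qed.

Lemma hdot_cre1 f g :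
  << fock_cre F f Phi, fock_cre F g Phi >> = 2 * c%:C%C * L2oo_dot f g.
Proof.
rewrite cre_adj// (ann_cre_iter f g 0) mulr0 scale0r addr0 hdotZr hdot_vac.
by rewrite !mulr1.
Qed.

Lemma hdot_cre2 u v g h :
  << fock_cre F u (fock_cre F v Phi), fock_cre F g (fock_cre F h Phi) >> =
  2 * c%:C%C *
   (2 * c%:C%C * (L2oo_dot u h * L2oo_dot v g + L2oo_dot u g * L2oo_dot v h)
    + 8 * L2oo_dot v (L2oo_mul (L2oo_mul (L2oo_conj u) g) h)).
Proof.
rewrite cre_adj//.
have /eqP := ann_cre u g (cre_dom h (vac_dom F)).
rewrite subr_eq (ann_cre_iter u h 0) (num_cre_iter _ h 0) mulr0 scale0r addr0 =>
  /eqP ->.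
rewrite creZ//.
by rewrite !hdotDr !hdotZr !hdot_cre1; ring.
Qed.

Lemma hdot_cre_cre_iter h f n :
  << fock_cre F h (cre_iter f n), cre_iter f n.+1 >> =
  2 * c%:C%C * n.+1%:R * L2oo_dot h f * << cre_iter f n, cre_iter f n >> +
  4 * n.+1%:R * n%:R *
    << cre_iter f n,
       fock_cre F (L2oo_mul (L2oo_mul (L2oo_conj h) f) f) (cre_iter f n.-1) >>.
Proof. by rewrite cre_adj// ann_cre_iter hdotDr !hdotZr. Qed.

Hypothesis hc : 0 < c.

(** The right-hand side of [hdot_cre_cre_iter] contains the conjugate of the
    same quantity in degree [n.-1], with [h] replaced by [conj h * f * f]; the
    sign condition is inherited because the new product is [|f|^2] times the
    old one. *)
Lemma hdot_cre_cre_iter_ge0 h f n :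
  {ae mu, forall t, 0 <= (h t)^* * f t} ->
  0 <= << fock_cre F h (cre_iter f n), cre_iter f n.+1 >>.
Proof.
have c0 : 0 <= c%:C%C by rewrite lecR ltW.
have N0 k : 0 <= << cre_iter f k, cre_iter f k >> := hdot_ge0 nE _.
elim: n h => [|n IH] h hf; rewrite hdot_cre_cre_iter.
  by rewrite mulr0 mul0r addr0 !mulr_ge0// L2oo_dot_ge0.
rewrite addr_ge0//; first by rewrite !mulr_ge0// L2oo_dot_ge0.
rewrite mulr_ge0// hdotC conjC_ge0; apply: IH.
have e1 := L2oo_mulx (L2oo_mul (L2oo_conj h) f) f.
have e2 := L2oo_mulx (L2oo_conj h) f; have e3 := L2oo_conjx h.
near=> t.
have -> : L2oo_mul (L2oo_mul (L2oo_conj h) f) f t = (h t)^* * f t * f t.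
  by rewrite (near e1 t)// (near e2 t)// (near e3 t).
have hfx : 0 <= (h t)^* * f t by near: t.
rewrite rmorphM/= (conj_Creal (ger0_real hfx)) -mulrA mulr_ge0//.
by rewrite mulrC -normCK exprn_ge0.
Unshelve. all: by end_near. Qed.

(** For [n > 0] the mixed term is the quantity of [hdot_cre_cre_iter_ge0] for
    [h = |f|^2 f], and that lemma applied to [M^2 f - |f|^2 f] bounds it by
    [M^2] times the squared norm. *)
Lemma cre_iter_ratio f (M : R) n : 0 <= M ->
  {ae mu, forall t, normc (f t) <= M} ->
  `|cre_iter f n.+1| ^+ 2 <=
    (2 * c%:C%C * n.+1%:R * L2oo_dot f f + 4 * n.+1%:R * n%:R * (M ^+ 2)%:C%C)
    * `|cre_iter f n| ^+ 2.
Proof.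
move=> M0 fM; case: n => [|n].
  by rewrite !nE [leLHS](hdot_cre_cre_iter f f 0) !mulr0 !mul0r !addr0.
rewrite !nE /= [leLHS](hdot_cre_cre_iter f f n.+1) [leRHS]mulrDl lerD2l
  -[leRHS]mulrA.
rewrite ler_wpM2l// hdotC.
set h := L2oo_mul _ _.
have : 0 <= << fock_cre F ((M ^+ 2)%:C%C *: f - h) (cre_iter f n),
  cre_iter f n.+1 >>.
  apply: hdot_cre_cre_iter_ge0.
  have e1 := L2oo_mulx (L2oo_mul (L2oo_conj f) f) f.
  have e2 := L2oo_mulx (L2oo_conj f) f; have e3 := L2oo_conjx f.
  have e4 := L2oo_subx ((M ^+ 2)%:C%C *: f) h.
  have e5 := L2oo_scalex ((M ^+ 2)%:C%C) f.
  near=> t.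
  have -> : ((M ^+ 2)%:C%C *: f - h : A) t =
      (M ^+ 2)%:C%C * f t - (f t)^* * f t * f t.
    by rewrite (near e4 t)// (near e5 t)// (near e1 t)// (near e2 t)//
      (near e3 t).
  have fMt : normc (f t) <= M by near: t.
  rewrite -mulrBl rmorphM/= -mulrA normc_conj_mul mulr_ge0 ?lecR ?sqr_ge0//.
  rewrite -rmorphB conj_Creal ?complex_real// lecR subr_ge0.
  by rewrite ler_pXn2r ?nnegrE ?normc_ge0.
rewrite creBl// creZl// hdotBl hdotZl conj_Creal ?complex_real// subr_ge0 =>
  hle.
by rewrite conj_Creal// (ler_real hle) ger0_real// mulr_ge0 ?lecR ?sqr_ge0//
  hdot_ge0.
Unshelve. all: by end_near. Qed.

End fock_vectors.

(** * Convergence of the exponential vectors *)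

Section exponential_vectors.
Context {dd : measure_display} {T : measurableType dd} {R : realType}.
Context {mu : {measure set T -> \bar R}} {c : R}.
Variable F : rswn_fock mu c.
Hypothesis hc : 0 < c.
Local Notation A := (L2oo mu).
Local Notation normc := (@ComplexField.Normc.normc R).
Implicit Types (f g h u v : A) (n m : nat) (x y : F).

Definition exp_term f n : F := (n`!%:R)^-1 *: cre_iter F f n.

Lemma exp_term_ratio f (M : R) n : 0 <= M ->
  {ae mu, forall t, normc (f t) <= M} ->
  `|exp_term f n.+1| ^+ 2 <=
    (2 * c%:C%C * L2oo_dot f f / n.+1%:R + ((2 * M) ^+ 2)%:C%C)
    * `|exp_term f n| ^+ 2.
Proof.
move=> M0 fM; rewrite /exp_term !normrZ !exprMn !normfV !normr_nat.
have n0 : 0 < (n`!%:R : R[i]) by rewrite ltr0n fact_gt0.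
rewrite factS natrM invfM exprMn -mulrA mulrCA [leRHS]mulrCA ler_wpM2l//.
rewrite (le_trans (ler_wpM2l _ (cre_iter_ratio F hc n M0 fM)))//.
rewrite mulrA ler_wpM2r ?exprn_ge0//.
set N : R[i] := n.+1%:R; have N0 : N != 0 by rewrite pnatr_eq0.
have -> : N^-1 ^+ 2 *
    (2 * c%:C%C * N * L2oo_dot f f + 4 * N * n%:R * (M ^+ 2)%:C%C) =
    2 * c%:C%C * L2oo_dot f f / N + n%:R / N * (4 * (M ^+ 2)%:C%C).
  by field.
rewrite -natrX [X in _ <= _ + X]rmorphM rmorph_nat.
rewrite lerD2l ler_piMl ?mulr_ge0 ?lecR ?exprn_ge0//.
by rewrite ler_pdivrMr ?ltr0n// mul1r ler_nat.
Qed.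

(** With [M < 1/2] the ratio [s = M + 1/2] lies strictly between [2 M] and [1],
    so it eventually dominates the ratio of consecutive terms. *)
Lemma exp_term_geometric f : small f ->
  exists K s : R, 0 < s < 1 /\ forall n, `|exp_term f n| <= (K * s ^+ n)%:C%C.
Proof.
move=> /small_bound[M [M0 M2 fM]].
have ff0 : 0 <= L2oo_dot f f.
  by apply: L2oo_dot_ge0; apply: nearW => t;
    rewrite normc_conj_mul lecR sqr_ge0.
pose a : R := 2 * c * complex.Re (L2oo_dot f f).
have aE : a%:C%C = 2 * c%:C%C * L2oo_dot f f.
  by rewrite -[in RHS](RRe_real (ger0_real ff0)) /a !rmorphM rmorph_nat.
have a0 : 0 <= a by rewrite -lecR aE !mulr_ge0// lecR ltW.
pose s := M + 2^-1.
have s0 : 0 < s by rewrite ltr_wpDl// invr_gt0.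
have s1 : s < 1 by rewrite /s; move: M2; lra.
have Ms : (2 * M) ^+ 2 < s ^+ 2.
  have Ms : 2 * M < s by rewrite /s; move: M2; lra.
  by rewrite ltrXn2r ?nnegrE ?mulr_ge0 ?(ltW s0).
pose nr n : R := complex.Re `|exp_term f n|.
have nrE n : (nr n)%:C%C = `|exp_term f n| by rewrite RRe_real ?normr_real.
have nr0 n : 0 <= nr n by rewrite -lecR nrE; exact: normr_ge0.
have [|K uK] := @eventually_geometric _ nr s s0.
  have : (fun n => a * n.+1%:R^-1) @ \oo --> (a * 0 : R).
    by apply: cvgM; [exact: cvg_cst|exact: cvg_harmonic].
  rewrite mulr0 => /cvgrPdist_lt /(_ (s ^+ 2 - (2 * M) ^+ 2)).
  rewrite subr_gt0 => /(_ Ms) [N _ aN]; exists N => n /aN /=.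
  rewrite sub0r normrN => /(le_lt_trans (ler_norm _)) an.
  rewrite -(@ler_pXn2r _ 2)// ?nnegrE ?mulr_ge0// ?(ltW s0)// exprMn.
  rewrite -lecR rmorphXn/= nrE (le_trans (exp_term_ratio n M0 fM))//.
  rewrite -aE -nrE -[_.+1%:R](rmorph_nat (real_complex R)) -fmorphV -rmorphM
    -rmorphD -rmorphXn.
  by rewrite -rmorphM lecR ler_wpM2r ?exprn_ge0// -lerBrDr ltW.
by exists K, s; rewrite s0 s1; split=> // n; rewrite -nrE lecR.
Qed.

Lemma expvec_cvg f : small f -> series (exp_term f) @ \oo --> expvec F f.
Proof.
by move=> /exp_term_geometric[K [s [s01 tK]]];
  exact: cvg_series_geometric s01 tK.
Qed.

End exponential_vectors.

(** * From a multiplication operator to a projection *)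

Section multiplication_to_projection.
Context {dd : measure_display} {T : measurableType dd} {R : realType}.
Context {mu : {measure set T -> \bar R}} {c : R}.
Variable F : rswn_fock mu c.
Hypothesis hc : 0 < c.
Variables (I : set T) (mI : measurable I).
Local Notation A := (L2oo mu).
Local Notation Phi := (fock_vac F).
Local Notation "'<<' x , y '>>'" := (hdot (fock_form F) x y).
Implicit Types (f g h u v : A) (n m : nat) (x y : F).

Let nE := fun x : F => fock_normE x.

(** The range of the projection will be the orthogonal complement of these
    states; described in this way it is closed from the start, unlike the span
    of the exponential vectors of functions supported in [I]. *)
Definition off_states : set F :=
  [set y | exists g x,
    [/\ L2oo_restr mI g = 0, fock_dom x & y = fock_cre F g x]].

Lemma restr_ae0 g : L2oo_restr mI g = 0 -> {ae mu, forall t, \1_I t * g t = 0}.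
Proof.
move=> g0; have := L2oo_restrx mI g; rewrite g0.
by apply: filterS2 (L2oo_0x mu) => t ->.
Qed.

Lemma ann_restr g h n : L2oo_restr mI g = 0 ->
  fock_ann F g (cre_iter F (L2oo_restr mI h) n) = 0.
Proof.
move=> /restr_ae0 g0; have hI := L2oo_restrx mI h.
set r := L2oo_restr mI h in hI *.
have gr0 : {ae mu, forall t, (g t)^* * r t = 0}.
  apply: filterS2 g0 hI => t; rewrite indicE => + ->.
  by case: (t \in I); rewrite ?mul0r ?mulr0// !mul1r => ->;
    rewrite conjC0 mul0r.
case: n => [|n]; first exact: ann_vac.
rewrite ann_cre_iter L2oo_dot_ae0// (_ : L2oo_mul _ r = 0).
  by rewrite cre0l ?mulr0 ?scale0r ?scaler0 ?addr0//; exact: cre_iter_dom.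
apply: L2oo_eq0; have e1 := L2oo_mulx (L2oo_mul (L2oo_conj g) r) r.
have e2 := L2oo_mulx (L2oo_conj g) r; have e3 := L2oo_conjx g.
near=> t; rewrite (near e1 t)// (near e2 t)// (near e3 t)// (near gr0 t)//
  mul0r//.
Unshelve. all: by end_near. Qed.

Lemma cre_iter_restr_orth h n :
  orth (fock_form F) off_states (cre_iter F (L2oo_restr mI h) n).
Proof.
move=> _ [g [x [g0 dx ->]]].
by rewrite cre_adj ?ann_restr ?hdot0r//; exact: cre_iter_dom.
Qed.

Lemma restr_compl f : L2oo_restr mI (f - L2oo_restr mI f) = 0.
Proof.
apply: L2oo_eq0; have e1 := L2oo_restrx mI (f - L2oo_restr mI f).
have e2 := L2oo_subx f (L2oo_restr mI f); have e3 := L2oo_restrx mI f.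
near=> t; rewrite (near e1 t)// (near e2 t)// (near e3 t)// indicE.
by case: (t \in I); rewrite ?mul0r// !mul1r subrr.
Unshelve. all: by end_near. Qed.

(** Expand [B_f = B_(r f) + B_(f - r f)], where [r] is the restriction to [I];
    as creators commute, every term but one has a factor [B_(f - r f)] that can
    be moved to the front. *)
Lemma cre_iter_restr_decomposition f n : exists2 x, fock_dom x &
  cre_iter F f n = cre_iter F (L2oo_restr mI f) n +
    fock_cre F (f - L2oo_restr mI f) x.
Proof.
set r := L2oo_restr mI f; set g := f - r.
have fE : f = r + g by rewrite addrC subrK.
have dD x y : fock_dom x -> fock_dom y -> fock_dom (x + y).
  by move=> dx dy; rewrite -[x]scale1r; exact: fock_dom_lin.
elim: n => [|n [x dx IH]]; first by exists 0; [exact: dom0|rewrite cre0r addr0].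
exists (cre_iter F r n + fock_cre F f x).
  by apply: dD; [exact: cre_iter_dom|exact: cre_dom].
have creDr h y z : fock_dom y -> fock_dom z ->
    fock_cre F h (y + z) = fock_cre F h y + fock_cre F h z.
  by move=> dy dz; rewrite -[y]scale1r cre_linr// !scale1r.
have dr := cre_iter_dom F r n; have dgx := cre_dom g dx;
  have dfx := cre_dom f dx.
rewrite -[LHS]/(fock_cre F f (cre_iter F f n)) IH !creDr// addrA.
by rewrite [in X in X + _ = _]fE creDl// (cre_cre f).
Qed.

Lemma hdot_cre_iter_restr k f n : orth (fock_form F) off_states k ->
  << k, cre_iter F f n >> = << k, cre_iter F (L2oo_restr mI f) n >>.
Proof.
move=> ok; have [x dx ->] := cre_iter_restr_decomposition f n.
rewrite hdotDr [X in _ + X]hdotC ok ?conjC0 ?addr0//.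
by exists (f - L2oo_restr mI f), x; split; rewrite ?restr_compl.
Qed.

Lemma restr_projection : exists2 P : {linear F -> F}, orthogonal_projection P &
  forall f, small f -> small (L2oo_restr mI f) ->
    P (expvec F f) = expvec F (L2oo_restr mI f).
Proof.
have [P [P_uniq Pcontr Pidem Padj]] := orth_projection nE off_states.
exists P.
  by split => //; exists 1 => x; rewrite mul1r.
move=> f sf sr; have cf := expvec_cvg (F := F) hc sf;
  have cr := expvec_cvg (F := F) hc sr.
apply: P_uniq.
  apply: (orth_cvg nE cr); elim=> [|n IH].
    by rewrite /series/= big_nil; exact: orth0.
  rewrite seriesSr addrC; apply: orth_comb => //; exact: cre_iter_restr_orth.
move=> k ok; rewrite hdotBr; apply/eqP; rewrite subr_eq0; apply/eqP.
have := cvg_hdot nE (k := k) cr.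
rewrite (_ : (fun n => << k, series _ n >>) =
    (fun n => << k, series (exp_term F f) n >>)).
  by move=> cr'; apply: cvg_unique (cvg_hdot nE (k := k) cf) cr'.
apply/funext; elim=> [|n IH]; first by rewrite /series/= !big_nil.
rewrite !seriesSr !hdotDr IH /exp_term !hdotZr; congr (_ + _ * _).
by rewrite [RHS]hdot_cre_iter_restr.
Qed.

End multiplication_to_projection.

(** * From a projection to a multiplication operator *)

Section projection_to_multiplication.
Context {dd : measure_display} {T : measurableType dd} {R : realType}.
Context {mu : {measure set T -> \bar R}} {c : R}.
Variable F : rswn_fock mu c.
Hypothesis hc : 0 < c.
Local Notation A := (L2oo mu).
Local Notation Phi := (fock_vac F).
Local Notation "'<<' x , y '>>'" := (hdot (fock_form F) x y).
Implicit Types (f g h u v w : A) (n m : nat) (x y : F).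

Variable p : {linear A -> A}.
Hypothesis p_small : forall f, small f -> small (p f).
Variable P : {linear F -> F}.
Hypothesis Pproj : orthogonal_projection P.
Hypothesis PE : forall f, small f -> P (expvec F f) = expvec F (p f).

Let nE := fun x : F => fock_normE x.

(** The bound in the definition of a projection is unspecified; self-adjointness
    and idempotence make it [1]. *)
Lemma projection_contraction x : `|P x| <= `|x|.
Proof.
have [_ Pidem Padj] := Pproj.
have [->|Px0] := eqVneq (P x) 0; first by rewrite normr0.
rewrite -(ler_pM2r (_ : 0 < `|P x|)) ?normr_gt0// -expr2 nE Padj Pidem.
rewrite -(@ger0_norm _ << x, P x >>); first exact: cauchy_schwarz.
by rewrite -[P x]Pidem -Padj hdot_ge0.
Qed.

Lemma projection_cvg (u : nat -> F) y :
  u @ \oo --> y -> (fun n => P (u n)) @ \oo --> P y.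
Proof.
move=> uy; apply/cvgrPdist_lt => e e0.
move/cvgrPdist_lt : uy => /(_ _ e0); apply: filterS => n.
by rewrite -linearB; apply: le_lt_trans; exact: projection_contraction.
Qed.

Lemma cre_iterZ (a : R[i]) f n :
  cre_iter F (a *: f) n = a ^+ n *: cre_iter F f n.
Proof.
elim: n => [|n IH]; first by rewrite scale1r.
rewrite -[LHS]/(fock_cre F (a *: f) (cre_iter F (a *: f) n)) IH.
by rewrite creZ ?creZl ?scalerA -?exprSr//; exact: cre_iter_dom.
Qed.

(** Compare coefficients in [P Psi(t f) = Psi(t p f)], for [t] in [(0, 1]]. *)
Lemma projection_cre_iter_small f n : small f ->
  P (cre_iter F f n) = cre_iter F (p f) n.
Proof.
move=> sf; have spf := p_small sf.
have n0 k : (k`!%:R : R[i]) != 0 by rewrite pnatr_eq0 -lt0n fact_gt0.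
have [K1 [s1 [/andP[s10 s11] tK1]]] := exp_term_geometric F hc sf.
have [K2 [s2 [/andP[s20 s21] tK2]]] := exp_term_geometric F hc spf.
suff : P (exp_term F f n) - exp_term F (p f) n = 0.
  move=> /eqP; rewrite subr_eq0 /exp_term linearZ => /eqP /=.
  by move/scalerI; apply; rewrite invr_eq0.
have le_geom (K s : R) k : 0 < s -> s < 1 ->
    0 <= K * s ^+ k -> K * s ^+ k <= K.
  move=> s0 s1' Ks; rewrite ler_piMr ?exprn_ile1 ?(ltW s0) ?(ltW s1')//.
  by rewrite -(pmulr_lge0 _ (exprn_gt0 k s0)).
have ge0 (g : A) (K s : R) k :
    `|exp_term F g k| <= (K * s ^+ k)%:C%C -> 0 <= K * s ^+ k.
  by move=> h; rewrite -lecR; exact: le_trans (normr_ge0 _) h.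
apply: (@power_series_eq0 _ _
  (fun k => P (exp_term F f k) - exp_term F (p f) k) (K1 + K2)).
  move=> k; rewrite (le_trans (ler_normB _ _))// rmorphD lerD//.
    rewrite (le_trans (projection_contraction _))// (le_trans (tK1 k))// lecR.
    by rewrite le_geom// (ge0 f).
  by rewrite (le_trans (tK2 k))// lecR le_geom// (ge0 (p f)).
move=> t t01; have stf := small_shrink t01 sf.
have scale g k : exp_term F (t%:C%C *: g) k = (t ^+ k)%:C%C *: exp_term F g k.
  by rewrite /exp_term cre_iterZ !scalerA mulrC rmorphXn.
have pZ : p (t%:C%C *: f) = t%:C%C *: p f := linearZ _ _.
have PZ a x : P (a *: x) = a *: P x := linearZ _ _.
have cv1 := projection_cvg (expvec_cvg (F := F) hc stf).
have cv2 := expvec_cvg (F := F) hc (p_small stf).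
have -> : series
      (fun k => (t ^+ k)%:C%C *: (P (exp_term F f k) - exp_term F (p f) k)) =
    (fun n => P (series (exp_term F (t%:C%C *: f)) n))
    - series (exp_term F (p (t%:C%C *: f))).
  apply/funext; elim=> [|k IH].
    by rewrite !fctE /series/= !big_nil linear0 subrr.
  move: IH; rewrite !fctE => IH.
  rewrite !seriesSr [P (_ + _)]linearD [X in _ = _ + X]opprD.
  by rewrite [RHS]addrACA -IH pZ !scale (PZ (t ^+ k)%:C%C) -scalerBr.
by rewrite -(subrr (P (expvec F (t%:C%C *: f)))) {2}PE//; exact: cvgB.
Qed.

Lemma projection_cre_iter f n : P (cre_iter F f n) = cre_iter F (p f) n.
Proof.
have [t t0 st] := small_scale f.
have tn0 : t%:C%C ^+ n != 0 :> R[i] by rewrite expf_neq0// gt_eqF// ltcR.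
have := projection_cre_iter_small n st; rewrite linearZ !cre_iterZ linearZ/=.
exact: scalerI.
Qed.

Lemma projection_cre1 f : P (fock_cre F f Phi) = fock_cre F (p f) Phi.
Proof. exact: (projection_cre_iter f 1). Qed.

(** Polarization of the degree two case of [projection_cre_iter]. *)
Lemma projection_cre2 f g :
  P (fock_cre F f (fock_cre F g Phi)) = fock_cre F (p f) (fock_cre F (p g) Phi).
Proof.
have dv := vac_dom F; have dc h := cre_dom h dv.
have square u v : cre_iter F (u + v) 2 =
    cre_iter F u 2 + cre_iter F v 2 + 2 *: fock_cre F u (fock_cre F v Phi).
  rewrite /cre_iter /= creDl// [fock_cre F (u + v) Phi]creDl//.
  have creDr h : fock_cre F h (fock_cre F u Phi + fock_cre F v Phi) =
    fock_cre F h (fock_cre F u Phi) + fock_cre F h (fock_cre F v Phi).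
    by rewrite -[fock_cre F u Phi]scale1r cre_linr// !scale1r.
  rewrite !creDr (cre_cre v u)// scaler_nat mulr2n.
  by rewrite [X in _ + X]addrC addrACA.
have PD x y : P (x + y) = P x + P y := linearD _ _ _.
have PZ a x : P (a *: x) = a *: P x := linearZ _ _.
have pD : p (f + g) = p f + p g := linearD _ _ _.
have := projection_cre_iter (f + g) 2;
  rewrite pD !square !PD PZ !projection_cre_iter.
by move=> /addrI /scalerI; apply; rewrite pnatr_eq0.
Qed.

Lemma c2_neq0 : 2 * c%:C%C != 0 :> R[i].
Proof. by rewrite gt_eqF// mulr_gt0// ltcR. Qed.

Lemma cre_vac_eq0 f : fock_cre F f Phi = 0 -> f = 0.
Proof.
move=> f0; apply: L2oo_dot_eq0; apply: (mulfI c2_neq0).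
by rewrite -(hdot_cre1 F) f0 hdot0r mulr0.
Qed.

Lemma p_idem f : p (p f) = p f.
Proof.
have [_ Pidem _] := Pproj.
apply/eqP; rewrite -subr_eq0; apply/eqP/cre_vac_eq0.
rewrite creBl; last exact: vac_dom.
by rewrite -!projection_cre1 Pidem subrr.
Qed.

(** With [u = p f], the degree one identity gives [<u, v> = 0] and the degree
    two identity then gives [<u, conj u v w> = 0] for all [w]; for
    [w = u u conj v] the integrand is [|w|^2]. *)
Lemma range_kernel_disjoint f v :
  p v = 0 -> {ae mu, forall t, (p f : A) t * v t = 0}.
Proof.
move=> pv0; have [_ _ Padj] := Pproj; set u : A := p f.
have dv := vac_dom F; have dc h := cre_dom h dv.
have uv0 : L2oo_dot u v = 0.
  apply: (mulfI c2_neq0); rewrite -(hdot_cre1 F) /u -projection_cre1 Padj.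
  by rewrite projection_cre1 pv0 cre0l// hdot0r mulr0.
have uuvw w : L2oo_dot u (L2oo_mul (L2oo_mul (L2oo_conj u) v) w) = 0.
  have : << fock_cre F u (fock_cre F u Phi),
            fock_cre F v (fock_cre F w Phi) >> = 0.
    by rewrite -projection_cre2 Padj projection_cre2 pv0 cre0l// hdot0r.
  rewrite hdot_cre2 uv0 mulr0 mul0r addr0 mulr0 add0r => /eqP.
  by rewrite mulf_eq0 (negbTE c2_neq0) /= mulf_eq0 pnatr_eq0/= => /eqP.
pose z := L2oo_mul (L2oo_mul u u) (L2oo_conj v).
have e1 := L2oo_mulx (L2oo_mul u u) (L2oo_conj v).
have e2 := L2oo_mulx u u; have e3 := L2oo_conjx v.
have z0 : z = 0.
  apply: L2oo_dot_eq0; rewrite -(uuvw z); apply: L2oo_dot_ae.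
  have e4 := L2oo_mulx (L2oo_mul (L2oo_conj u) v) z.
  have e5 := L2oo_mulx (L2oo_conj u) v; have e6 := L2oo_conjx u.
  near=> t; rewrite (near e4 t)// (near e5 t)// (near e6 t)//.
  have -> : z t = u t * u t * (v t)^*.
    by rewrite (near e1 t)// (near e2 t)// (near e3 t).
  by rewrite !rmorphM/= conjCK; ring.
have e0 := L2oo_0x mu; near=> t.
have : z t = u t * u t * (v t)^*.
  by rewrite (near e1 t)// (near e2 t)// (near e3 t).
rewrite z0 (near e0 t)// => /esym/eqP.
rewrite !mulf_eq0 conjC_eq0 orbb => /orP[] /eqP ->; first by rewrite mul0r.
by rewrite mulr0.
Unshelve. all: by end_near. Qed.

End projection_to_multiplication.

(** * Projections with disjoint range and kernel *)

(** Exhaust the space by sets [E n] of finite measure with indicators [e n], and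
    let [I] be the union of the supports of the [p (e n)].  On [I] some
    [p (e n)] is nonzero, which forces [f - p f] to vanish; off [I] all
    [p (e n)] vanish, so [e n - p (e n) = 1] on [E n], which forces [p f] to
    vanish. *)
Lemma disjoint_projection_indicator {dd : measure_display}
    {T : measurableType dd} {R : realType}
    (mu : {sigma_finite_measure set T -> \bar R})
    (p : {linear L2oo mu -> L2oo mu}) :
  (forall f, p (p f) = p f) ->
  (forall f v : L2oo mu, p v = 0 ->
    {ae mu, forall t, (p f : L2oo mu) t * v t = 0}) ->
  exists (I : set T) (mI : measurable I), forall f, p f = L2oo_restr mI f.
Proof.
move=> pp disj.
have [E ET Efin] := sigma_finiteT mu.
pose e n : L2oo mu := L2oo_indic (proj1 (Efin n)) (proj2 (Efin n)).
pose pe n : L2oo_fun mu := L2oo_repr (p (e n)).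
pose I := \bigcup_n [set t | pe n t != 0].
have mI : measurable I.
  apply: bigcupT_measurable => n.
  rewrite (_ : [set t | _] =
    ~` ((@complex.Re R \o pe n) @^-1` [set 0] `&`
        (@complex.Im R \o pe n) @^-1` [set 0])).
    have [mr mi] := measurable_Re_Im (pe n).
    apply: measurableC; apply: measurableI; rewrite -[X in measurable X]setTI.
      by apply: mr => //; exact: measurable_set1.
    by apply: mi => //; exact: measurable_set1.
  apply/seteqP; split=> t /=; case: (pe n t) => a b.
    by move=> + [/= a0 b0]; rewrite a0 b0 eqxx.
  by move=> ab; apply/eqP => -[a0 b0]; apply: ab.
exists I, mI => f; apply/L2ooP.
have ker g : p (g - p g) = 0 by rewrite linearB/= pp subrr.
have d1 : {ae mu, forall t, forall n,
  (p f : L2oo mu) t * (e n - p (e n) : L2oo mu) t = 0}.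
  by apply/ae_foralln => n; exact: disj.
have d2 : {ae mu, forall t, forall n,
  (p (e n) : L2oo mu) t * (f - p f : L2oo mu) t = 0}.
  by apply/ae_foralln => n; exact: disj.
have e1 : {ae mu, forall t, forall n, e n t = \1_(E n) t}.
  by apply/ae_foralln => n; exact: L2oo_class_ae.
have e2 : {ae mu, forall t, forall n,
  (e n - p (e n) : L2oo mu) t = e n t - (p (e n) : L2oo mu) t}.
  by apply/ae_foralln => n; exact: L2oo_subx.
have e3 := L2oo_subx f (p f); have e4 := L2oo_restrx mI f.
near=> t; rewrite (near e4 t)//.
have d1t n : (p f : L2oo mu) t * (e n - p (e n) : L2oo mu) t = 0.
  by move: n; near: t.
have d2t n : (p (e n) : L2oo mu) t * (f - p f : L2oo mu) t = 0.
  by move: n; near: t.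
have e1t n : e n t = \1_(E n) t by move: n; near: t.
have e2t n : (e n - p (e n) : L2oo mu) t = e n t - (p (e n) : L2oo mu) t.
  by move: n; near: t.
have e3t : (f - p f : L2oo mu) t = (f : L2oo mu) t - (p f : L2oo mu) t.
  by near: t.
have [tI|tI] := pselect (I t).
  rewrite indicE mem_set// mul1r.
  have [n _ /= /negbTE pn0] := tI.
  have /eqP := d2t n; rewrite e3t mulf_eq0 [X in X || _]pn0/= subr_eq0.
  by move=> /eqP.
rewrite indicE memNset// mul0r.
have [n _ Ent] : (\bigcup_n E n) t by rewrite -ET.
have pn0 : (p (e n) : L2oo mu) t = 0.
  by apply/eqP/negPn/negP => pn0; apply: tI; exists n.
by have := d1t n; rewrite e2t e1t pn0 indicE mem_set// subr0 mulr1.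
Unshelve. all: by end_near. Qed.

Theorem theorem2 (R : realType) (d : nat) (c : R) (hc : 0 < c)
    (F : rswn_fock (lebesgue_tuple R d) c)
    (p : {linear L2oo (lebesgue_tuple R d) -> L2oo (lebesgue_tuple R d)})
    (hp : forall f, (L2oo_norm (p f) <= L2oo_norm f)%E) :
  extends_to_orthogonal_projection (second_quantization F p) <->
  exists (I : set (d.-tuple (measurableTypeR R))) (mI : measurable I),
    forall f, p f = L2oo_restr mI f.
Proof.
have p_small f : small f -> small (p f) by exact: le_lt_trans (hp f).
split=> [[P Pproj PE]|[I [mI pI]]].
  have PexpE f : small f -> P (expvec F f) = expvec F (p f).
    move=> sf; apply: PE; exists 1%N, (fun=> 1), (fun=> f).
    by split=> //; rewrite big_ord1 scale1r.
  apply: disjoint_projection_indicator.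
    exact: (p_idem hc p_small Pproj PexpE).
  exact: (range_kernel_disjoint hc p_small Pproj PexpE).
have [P Pproj PE] := restr_projection F hc mI.
exists P => // x y [n [a [f [sf -> ->]]]].
rewrite linear_sum; apply: eq_bigr => i _.
by rewrite linearZ/= pI PE// -pI; exact: p_small.
Qed.
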